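(* Let $(A(\cdot),b(\cdot),b'(\cdot),c)$ be an explicit $s$-stage FCRKN method satisfying $$\sum_{i=1}^s b'_i(\alpha)=\alpha,\qquad \sum_{i=1}^s b_i(\alpha)=\frac{\alpha^2}{2}\qquad(\alpha\in[0,1]),$$ $$\sum_{j=1}^s a_{ij}(\alpha)=\frac{\alpha^2}{2}\qquad(\alpha\in[0,c_i],\ i=1,\dots,s),$$ and suppose the method is of uniform order two. Assume that $f$ is of class $C^1$ with respect to the second argument and that the solution $u$ is of piecewise class $C^4$. Then the method is of uniform order three if and only if $$\sum_{i=1}^s b'_i(\alpha)\,c_i^2=\frac{\alpha^3}{3}\quad\text{and}\quad \sum_{i=1}^s b_i(\alpha)\,c_i=\frac{\alpha^3}{6},\qquad \alpha\in[0,1],$$ and it is of discrete order three if and only if $$\sum_{i=1}^s b'_i(1)\,c_i^2=\frac13\quad\text{and}\quad \sum_{i=1}^s b_i(1)\,c_i=\frac16 .$$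
   Context: Spaces. For $r\in[0,\infty]$, $\mathcal C$ is the space of continuous functions $[-r,0]\to\mathbb R^d$ with the maximum norm $\|\varphi\|=\max_{\theta\in[-r,0]}|\varphi(\theta)|$, where $|\cdot|$ is an arbitrary norm on $\mathbb R^d$; $\mathcal C^1$ is the analogous space of continuously differentiable functions. For a function $u$, $u_t(\theta)=u(t+\theta)$, $\theta\in[-r,0]$. Dots denote time derivatives; a prime on $b'$, $\eta'$, $E'$ is part of the name and does not mean differentiation. Problem. The second order retarded functional differential equation is $\ddot u(t)=f(t,u_t)$, where $u_t\in\mathcal C^1$, $f:\Omega\to\mathbb R^d$, $\Omega$ is an open subset of $\mathbb R\times\mathcal C^1$, $f$ is continuous and has a derivative $f':\Omega\to\mathcal L(\mathcal C^1,\mathbb R^d)$ with respect to the second argument (here the prime does mean derivative) which is bounded and continuous with respect to the second argument. For each $(\sigma,\varphi)\in\Omega$ there is a unique non-continuable solution $u:[\sigma-r,\bar t)\to\mathbb R^d$ through $(\sigma,\varphi)$, i.e. $u$ satisfies the equation for $t\in[\sigma,\bar t)$ and $u_\sigma=\varphi$. Since the right-hand side does not depend on $\dot u$, nothing further is required of $\dot\varphi$ except the existence of the initial value $\dot\varphi(0)$. Method. An explicit $s$-stage functional continuous Runge--Kutta--Nyström (FCRKN) method is a quadruple $(A(\cdot),b(\cdot),b'(\cdot),c)$, where $A(\cdot)=(a_{ij}(\cdot))$ is a strictly lower-triangular $\mathbb R^{s\times s}$-valued polynomial function with $A(0)=0$, $b(\cdot)=(b_i(\cdot))$ and $b'(\cdot)=(b'_i(\cdot))$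 are $\mathbb R^s$-valued polynomial functions with $b(0)=b'(0)=0$, and $c\in\mathbb R^s$ with $c_1=0$, $c_i\ge0$ for $i=2,\dots,s$. Applied with stepsize $h$ to get the solution $u$ through $(\sigma,\varphi)$, it gives for $\alpha\in[0,1]$ $$\eta(\alpha h)=\varphi(0)+\alpha h\dot\varphi(0)+h^2\sum_{i=1}^s b_i(\alpha)K_i,\qquad \eta'(\alpha h)=\dot\varphi(0)+h\sum_{i=1}^s b'_i(\alpha)K_i,$$ where $K_i=f(\sigma+c_ih,Y^i_{c_ih})$ and the stage functions $Y^i:[-r,c_ih]\to\mathbb R^d$ are given by $Y^i(\alpha h)=\varphi(0)+\alpha h\dot\varphi(0)+h^2\sum_{j=1}^{i-1}a_{ij}(\alpha)K_j$ for $\alpha\in[0,c_i]$ and $Y^i(\theta)=\varphi(\theta)$ for $\theta\in[-r,0]$. With $y=u(\sigma+\cdot)$, the local errors on $[0,h]$ are $E=\eta-y$ and $E'=\eta'-\dot y$. Order. The method has (local) uniform order $p$ if, for a sufficiently smooth problem $\ddot u(t)=f(t,u_t)$, for $h$ small enough there exist some $C>0$ and $C'>0$ such that $\max_{\alpha\in[0,1]}\|E(\alpha h)\|\le Ch^{p+1}$ and $\max_{\alpha\in[0,1]}\|E'(\alpha h)\|\le C'h^{p+1}$. It has (local) discrete order $q$ if, likewise, $\|E(h)\|\le Ch^{q+1}$ and $\|E'(h)\|\le C'h^{q+1}$.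
   Formalization: Order requires the error bounds only for u of piecewise class C^k for some k (k=5 suffices), since with only C^4 the ''if'' part fails (f=|t|^{5/2}e); f is defined on an open subset of R×C, not R×C^1, because stage functions may have a corner at 0. *)

(* Defs.v *)
From HB Require Import structures.
From mathcomp Require Import all_boot all_order all_algebra.
From mathcomp Require Import all_classical all_reals all_analysis.
Set Implicit Arguments.
Unset Strict Implicit.
Unset Printing Implicit Defensive.
Import Order.TTheory GRing.Theory Num.Theory.
Import numFieldNormedType.Exports.
Local Open Scope classical_set_scope.
Local Open Scope ring_scope.

(* The arbitrary norm |.| of R^d.  The topology of 'rV[R]_d is the library's
   one (that of the max norm), which every norm induces. *)
Record vnorm (R : realType) (d : nat) := VNorm {
  vnorm_fun :> 'rV[R]_d -> R;
  vnormD : forall x y, vnorm_fun (x + y) <= vnorm_fun x + vnorm_fun y;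
  vnormZ : forall (a : R) x, vnorm_fun (a *: x) = `|a| * vnorm_fun x;
  vnorm_eq0 : forall x, vnorm_fun x = 0 -> x = 0 }.

Definition delay_set (R : realType) (r : \bar R) : set R :=
  [set th | (- r <= th%:E)%E /\ th <= 0].

(* Functions on [-r, 0] are represented by functions on R that vanish outside
   of it.  For finite r the condition at -oo is automatic; for r = +oo it says
   that the function is continuous on the compact [-oo, 0], which is what makes
   the norm a maximum.  The functions are continuous rather than C^1 because the
   stage functions of a method may have a corner at 0. *)
Definition phase_pred (R : realType) (d : nat) (r : \bar R) :
    {pred R -> 'rV[R]_d} :=
  mem [set phi : R -> 'rV[R]_d | [/\ {within delay_set r, continuous phi},
    cvg (phi x @[x --> -oo]) & forall th, ~ delay_set r th -> phi th = 0]].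

(* N only serves to attach the norm below to the type. *)
Record phase (R : realType) (d : nat) (N : vnorm R d) (r : \bar R) := Phase {
  phase_fun :> R -> 'rV[R]_d;
  phase_funP : phase_fun \in @phase_pred R d r }.

Section phase_space.
Context {R : realType} {d : nat} {N : vnorm R d} {r : \bar R}.
Local Notation V := 'rV[R]_d.
Local Notation C := (phase N r).
Local Notation I := (delay_set r).

HB.instance Definition _ := [isSub for @phase_fun R d N r].
HB.instance Definition _ := gen_eqMixin C.
HB.instance Definition _ := gen_choiceMixin C.

Lemma phase_submod_closed : submod_closed (@phase_pred R d r).
Proof.
split=> [|a f g].
  rewrite inE; split => //.
  - by move=> x; exact: cvg_cst.
  - exact: is_cvg_cst.
rewrite !inE => -[fc fl f0] [gc gl g0]; split.
- by move=> x; apply: cvgD; [apply: cvgZl_tmp; exact: fc|exact: gc].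
- by apply: is_cvgD => //; exact: is_cvgZl_tmp.
- by move=> th Ith; rewrite !fctE f0// g0// scaler0 addr0.
Qed.

HB.instance Definition _ := GRing.isSubmodClosed.Build _ _ (@phase_pred R d r)
  phase_submod_closed.
HB.instance Definition _ := [SubChoice_isSubLmodule of C by <:].

Definition phase_norm (phi : C) : R := sup [set N (phi th) | th in I].

Lemma vnorm0 : N 0 = 0.
Proof. by have := vnormZ N 0 0; rewrite scale0r normr0 mul0r. Qed.

Lemma vnorm_ge0 (x : V) : 0 <= N x.
Proof.
have := vnormD N x (- x); rewrite subrr vnorm0 -scaleN1r vnormZ normrN1 mul1r.
by rewrite -mulr2n pmulrn_lge0.
Qed.

Lemma vnorm_le : exists K, forall x : V, N x <= K * `|x|.
Proof.
exists (\sum_(i < d) N (delta_mx 0 i)) => x.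
rewrite {1}(row_sum_delta x) mulr_suml.
have Nsum (s : seq 'I_d) : N (\sum_(j <- s) x 0 j *: delta_mx 0 j) <=
    \sum_(j <- s) N (delta_mx 0 j) * `|x|.
  elim: s => [|j s IH].
    by rewrite !big_nil vnorm0.
  rewrite !big_cons (le_trans (vnormD _ _ _))// lerD// vnormZ mulrC.
  rewrite ler_wpM2l ?vnorm_ge0//.
  rewrite [leRHS]/Num.norm/= mx_normrE.
  exact: (@le_bigmax _ _ _ 0 (fun ij => `|x ij.1 ij.2|) (0, j)).
exact: Nsum.
Qed.

Lemma delay_set_closed : closed I.
Proof.
have -> : I = [set th : R | (- r <= th%:E)%E] `&` [set th | th <= 0].
  by apply/seteqP; split.
apply: closedI; last exact: closed_le.
case: r => [a| |] /=.
- rewrite (_ : mkset _ = [set th | - a <= th]); first exact: closed_ge.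
  by apply/seteqP; split => x /=; rewrite lee_fin.
- by rewrite (_ : mkset _ = setT)//; apply/seteqP; split => x //= _; exact: leNye.
- rewrite (_ : mkset _ = set0); first exact: closed0.
  by apply/seteqP; split => x.
Qed.

Lemma phase_has_ubound (phi : C) : has_ubound [set N (phi th) | th in I].
Proof.
have [K NK] := vnorm_le.
have := phase_funP phi; rewrite inE => -[phic phil _].
have [M [Mr phiM]] : exists M, M \is Num.real /\
    forall th, th < M -> `|phi th| <= `|lim (phi x @[x --> -oo])| + 1.
  have /cvgrPdist_le/(_ _ ltr01)[M [Mr HM]] := phil.
  exists M; split => // th /HM /= H.
  rewrite -lerBlDl (le_trans _ H)// distrC.
  exact: lerB_dist.
have cI : compact (I `&` `[M, 0]).
  apply: (@subclosed_compact _ _ `[M, 0]); last exact: subIsetr.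
    apply: closedI; [exact: delay_set_closed|exact: interval_closed].
  exact: segment_compact.
have cphi : {within I `&` `[M, 0], continuous phi}.
  by apply: continuous_subspaceW phic; exact: subIsetl.
have [B [Br HB]] := compact_bounded (continuous_compact cphi cI).
pose B' := Num.max (B + 1) (`|lim (phi x @[x --> -oo])| + 1).
have HB' th : I th -> `|phi th| <= B'.
  move=> Ith; rewrite le_max; have [thM|Mth] := ltP th M.
    by rewrite phiM// orbT.
  apply/orP; left; apply: (HB (B + 1)); first by rewrite ltrDl.
  by exists th => //; split => //=; rewrite in_itv/= Mth Ith.2.
have K0 : K <= `|K| by exact: ler_norm.
exists (`|K| * B') => _ [th /= Ith <-].
apply: (le_trans (NK _)); apply: (@le_trans _ _ (`|K| * `|phi th|)).
  by rewrite ler_wpM2r.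
by rewrite ler_wpM2l// HB'.
Qed.

Lemma phase_le_norm (phi : C) th : I th -> N (phi th) <= phase_norm phi.
Proof. by move=> Ith; apply: ub_le_sup; [exact: phase_has_ubound|exists th]. Qed.

Lemma phase_norm_le (phi : C) (B : R) : 0 <= B ->
  (forall th, I th -> N (phi th) <= B) -> phase_norm phi <= B.
Proof.
move=> B0 phiB; rewrite /phase_norm.
have [->|/set0P A0] := eqVneq [set N (phi th) | th in I] set0.
  by rewrite sup0.
by apply: ge_sup => // _ [th Ith <-]; exact: phiB.
Qed.

Lemma phase_norm_ge0 (phi : C) : 0 <= phase_norm phi.
Proof.
rewrite /phase_norm.
have [->|/set0P [_ [th Ith _]]] := eqVneq [set N (phi th) | th in I] set0.
  by rewrite sup0.
exact: le_trans (vnorm_ge0 _) (phase_le_norm phi Ith).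
Qed.

Lemma phase_normD (phi psi : C) :
  phase_norm (phi + psi) <= phase_norm phi + phase_norm psi.
Proof.
apply: phase_norm_le => [|th Ith]; first by rewrite addr_ge0// phase_norm_ge0.
by apply: (le_trans (vnormD N _ _)); apply: lerD; exact: phase_le_norm.
Qed.

Lemma phase_normZ_le (a : R) (phi : C) :
  phase_norm (a *: phi) <= `|a| * phase_norm phi.
Proof.
apply: phase_norm_le => [|th Ith]; first by rewrite mulr_ge0// phase_norm_ge0.
by rewrite vnormZ ler_wpM2l//; exact: phase_le_norm.
Qed.

Lemma phase_normZ (a : R) (phi : C) :
  phase_norm (a *: phi) = `|a| * phase_norm phi.
Proof.
apply/eqP; rewrite eq_le phase_normZ_le/=.
have [->|a0] := eqVneq a 0; first by rewrite normr0 mul0r phase_norm_ge0.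
rewrite -ler_pdivlMl ?normr_gt0// -normfV.
by rewrite -{1}(scalerK a0 phi) phase_normZ_le.
Qed.

Lemma phase_norm_eq0 (phi : C) : phase_norm phi = 0 -> phi = 0.
Proof.
move=> phi0; apply/val_inj/funext => th /=.
have [Ith|nIth] := pselect (I th).
  apply: (@vnorm_eq0 _ _ N); apply/eqP; rewrite eq_le vnorm_ge0 andbT -phi0.
  exact: phase_le_norm.
by have := phase_funP phi; rewrite inE => -[_ _ ->].
Qed.

HB.instance Definition _ := @Lmodule_isNormed.Build R C phase_norm
  phase_normD phase_normZ phase_norm_eq0.

End phase_space.

(* g restricted to [-r, 0] as an element of the phase space.  The value 0 taken
   when g is not continuous there is never used below: segments of solutions
   and of stage functions are continuous. *)
Definition segment (R : realType) (d : nat) (N : vnorm R d) (r : \bar R)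
  (g : R -> 'rV[R]_d) : phase N r := insubd 0 (g \_ (delay_set r)).

Section smoothness.
Context {R : realType} {V : normedModType R}.
Implicit Types (A : set R) (g : R -> V) (t : R).

(* Derivatives relative to A, hence one-sided at the end points of intervals. *)
Definition diff_quotient g t : R -> V := fun x => (x - t)^-1 *: (g x - g t).

Definition derivable_within A g t : Prop :=
  cvg (diff_quotient g t @ within A t^').

Definition derive_within A g t : V := lim (diff_quotient g t @ within A t^').

Definition class_C (k : nat) A g : Prop :=
  (forall i t, (i < k)%N -> A t ->
     derivable_within A (iter i (derive_within A) g) t) /\
  {within A, continuous (iter k (derive_within A) g)}.

(* B is the set of break points, finite on every compact subinterval of J. *)
Definition piecewise_class_C (k : nat) (J : set R) g : Prop :=
  exists B : set R,
    (forall a b, `[a, b] `<=` J -> finite_set (B `&` `[a, b])) /\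
    (forall a b, a < b -> `[a, b] `<=` J -> B `&` `]a, b[ = set0 ->
       class_C k `[a, b] g).

End smoothness.

Section equation.
Context {R : realType} {d : nat} {N : vnorm R d} {r : \bar R}.
Local Notation V := 'rV[R]_d.
Local Notation C := (phase N r).
Implicit Types (Omega : set (R * C)) (f : R * C -> V).

(* f is only meaningful on Omega. *)
Definition state_derivative f (x : R * C) : C -> V :=
  'd (fun psi : C => f (x.1, psi)) (x.2).

Definition C1_in_state Omega f : Prop :=
  forall t phi, Omega (t, phi) ->
    differentiable (fun psi : C => f (t, psi)) phi /\
    forall e : R, 0 < e -> \forall psi \near phi, forall chi : C,
      N (state_derivative f (t, psi) chi - state_derivative f (t, phi) chi)
        <= e * `|chi|.

Definition rfde Omega f : Prop :=
  [/\ open Omega, {in Omega, continuous f}, C1_in_state Omega f &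
    exists M : R, forall x (chi : C), Omega x ->
      N (state_derivative f x chi) <= M * `|chi|].

Definition forward_set (sigma : R) (T : \bar R) : set R :=
  [set t | sigma <= t /\ (t%:E < T)%E].

Definition solution_set (sigma : R) (T : \bar R) : set R :=
  [set t | (sigma%:E - r <= t%:E)%E /\ (t%:E < T)%E].

(* u solves the equation on [sigma - r, T[ and passes through (sigma, phi) with
   initial slope v.  For r > 0 the slope is the (left) derivative of phi at 0;
   for r = 0 the filter is trivial and v is a free initial datum. *)
Definition solution Omega f (sigma : R) (phi : C) (v : V) (T : \bar R)
    (u : R -> V) : Prop :=
  let J := forward_set sigma T in
  [/\ (sigma%:E < T)%E,
    diff_quotient phi 0 @ within (delay_set r) 0^' --> v /\
      (forall th, delay_set r th -> u (sigma + th) = phi th),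
    derive_within J u sigma = v &
    forall t, J t ->
      let ut : C := segment N r (fun th => u (t + th)) in
      [/\ Omega (t, ut), derivable_within J u t,
        derivable_within J (derive_within J u) t &
        derive_within J (derive_within J u) t = f (t, ut)]].

Definition noncontinuable_solution Omega f sigma phi v T (u : R -> V) : Prop :=
  solution Omega f sigma phi v T u /\
  ~ exists T' w, [/\ (T < T')%E, solution Omega f sigma phi v T' w &
      forall t, solution_set sigma T t -> w t = u t].

End equation.

Record ivp (R : realType) (d : nat) (N : vnorm R d) (r : \bar R) := Ivp {
  dom : set (R * phase N r);
  rhs : R * phase N r -> 'rV[R]_d;
  sigma : R;
  phi : phase N r;
  slope : 'rV[R]_d;
  tend : \bar R;
  sol : R -> 'rV[R]_d;
  ivp_rfde : rfde dom rhs;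
  ivp_dom : dom (sigma, phi);
  ivp_sol : noncontinuable_solution dom rhs sigma phi slope tend sol }.

Definition sol_set (R : realType) (d : nat) (N : vnorm R d) (r : \bar R)
  (P : ivp N r) : set R := @solution_set R r (sigma P) (tend P).

Record fcrkn (R : realType) (s : nat) := Fcrkn {
  rk_a : 'I_s -> 'I_s -> {poly R};
  rk_b : 'I_s -> {poly R};
  rk_b' : 'I_s -> {poly R};
  rk_c : 'I_s -> R;
  rk_a_lower : forall i j : 'I_s, (i <= j)%N -> rk_a i j = 0;
  rk_a0 : forall i j, (rk_a i j).[0] = 0;
  rk_b0 : forall i, (rk_b i).[0] = 0;
  rk_b'0 : forall i, (rk_b' i).[0] = 0;
  rk_c0 : forall i : 'I_s, val i = 0%N -> rk_c i = 0;
  rk_c_ge0 : forall i, 0 <= rk_c i }.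

Section method.
Context {R : realType} {d : nat} {N : vnorm R d} {r : \bar R} {s : nat}.
Variables (M : fcrkn R s) (P : ivp N r).
Local Notation V := 'rV[R]_d.
Implicit Types (h : R) (K : 'I_s -> V) (w : 'I_s -> {poly R}).

(* Summing over all j is harmless for the stages since rk_a vanishes for j >= i. *)
Definition nystrom h K w (alpha : R) : V :=
  phi P 0 + (alpha * h) *: slope P + h ^+ 2 *: \sum_j (w j).[alpha] *: K j.

Definition stage_fun h K (i : 'I_s) (th : R) : V :=
  if th <= 0 then phi P th else nystrom h K (rk_a M i) (th / h).

Definition is_stages h K : Prop := forall i,
  K i = rhs P (sigma P + rk_c M i * h,
               segment N r (fun th => stage_fun h K i (rk_c M i * h + th))).

Definition eta h K (alpha : R) : V := nystrom h K (rk_b M) alpha.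

Definition eta' h K (alpha : R) : V :=
  slope P + h *: \sum_i (rk_b' M i).[alpha] *: K i.

Definition err h K (alpha : R) : V :=
  eta h K alpha - sol P (sigma P + alpha * h).

Definition err' h K (alpha : R) : V :=
  eta' h K alpha -
  derive_within (forward_set (sigma P) (tend P)) (sol P) (sigma P + alpha * h).

Definition err_order (A : set R) (p : nat) : Prop :=
  exists h0 c c' : R, [/\ 0 < h0, 0 < c, 0 < c' &
    forall h K, 0 < h <= h0 -> is_stages h K -> forall alpha, A alpha ->
      N (err h K alpha) <= c * h ^+ p.+1 /\
      N (err' h K alpha) <= c' * h ^+ p.+1].

Let stage_step h K (i : 'I_s) : V :=
  rhs P (sigma P + rk_c M i * h,
         segment N r (fun th => stage_fun h K i (rk_c M i * h + th))).

Let stage_step_local h K1 K2 (i : 'I_s) :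
  (forall j : 'I_s, (j < i)%N -> K1 j = K2 j) ->
  stage_step h K1 i = stage_step h K2 i.
Proof.
move=> K12; rewrite /stage_step; congr (rhs P (_, segment N r _)).
apply/funext => th; rewrite /stage_fun /nystrom; case: ifP => // _.
congr (_ + _ *: _); apply: eq_bigr => j _.
by have [/K12->//|ij] := ltnP j i; rewrite rk_a_lower// horner0 !scale0r.
Qed.

Lemma is_stages_exists h : exists K, is_stages h K.
Proof.
exists (iter s (stage_step h) (fun=> 0)).
have iterS n (i : 'I_s) : (i < n)%N ->
    iter n.+1 (stage_step h) (fun=> 0) i = iter n (stage_step h) (fun=> 0) i.
  elim: n i => // n IH i; rewrite ltnS => le_in.
  by apply: stage_step_local => j ji; apply: IH; exact: leq_trans le_in.
by move=> i; rewrite -[LHS](iterS s i (ltn_ord i)).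
Qed.

Lemma is_stages_uniq h K1 K2 : is_stages h K1 -> is_stages h K2 -> K1 =1 K2.
Proof.
move=> HK1 HK2 i; have [n] := ubnP (i : nat); elim: n i => // n IH i.
rewrite ltnS => le_in; rewrite HK1 HK2; apply: stage_step_local => j ji.
by apply: IH; exact: leq_trans le_in.
Qed.

End method.

(* Order on the problems satisfying asm.  "Sufficiently smooth" means that there
   is some k such that the error bounds hold for all these problems whose solution
   is of piecewise class C^k; in general err' = O(h^(p+1)) takes one more
   derivative of the solution than err = O(h^(p+1)). *)
Section order.
Context {R : realType} {d : nat} {N : vnorm R d} {r : \bar R} {s : nat}.
Variables (asm : ivp N r -> Prop) (M : fcrkn R s) (p : nat).

Definition has_order (A : set R) : Prop :=
  exists k : nat, forall P : ivp N r,
    asm P -> piecewise_class_C k (sol_set P) (sol P) -> err_order M P A p.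

Definition uniform_order : Prop := has_order `[0, 1].
Definition discrete_order : Prop := has_order [set 1].

End order.

(* Main.v *)
Require Import Defs.
From HB Require Import structures.
From mathcomp Require Import all_boot all_order all_algebra.
From mathcomp Require Import all_classical all_reals all_analysis.
From mathcomp Require Import ring lra.
Set Implicit Arguments.
Unset Strict Implicit.
Unset Printing Implicit Defensive.
Import Order.TTheory GRing.Theory Num.Theory.
Import numFieldNormedType.Exports.
Local Open Scope classical_set_scope.
Local Open Scope ring_scope.

(** Write y(t) = sol(sigma + t), and y2, y3, y4 for the values at 0 of its second,
    third and fourth derivatives.

    Sufficiency.  For problems whose solution is of piecewise class C^5, all break
    points after sigma stay away from sigma, so on some [0, e] the solution has
    Taylor expansions with uniform remainders ([sol_expansion]).  By induction on
    the stages, K_i = y2 + c_i h y3 + (c_i h)^2/2 y4 + O(h^3) ([stage_bigO]): if this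
    holds for the earlier stages, the condition that sum_j a_ij(alpha) = alpha^2/2
    makes Y^i agree with y up to O(h^3) on [0, c_i h], and K_i is then as close to
    the second derivative of y at c_i h, since the right-hand side is Lipschitz in
    the state near (sigma, phi) ([rhs_lipschitz]).  The Lipschitz estimate needs the
    whole segment joining the two states inside the domain; this is where the
    continuity of t |-> y_t at 0 enters ([segment_near_initial]).  Inserting the
    expansion of K_i into the formulas for the method gives
      E(alpha h)  = h^2 (sum b_i - alpha^2/2) y2 + h^3 (sum b_i c_i - alpha^3/6) y3
                    + O(h^4),
      E'(alpha h) = h (sum b'_i - alpha) y2 + h^2 (sum b'_i c_i - alpha^2/2) y3
                    + h^3/2 (sum b'_i c_i^2 - alpha^3/3) y4 + O(h^4),
    so that the order conditions give order three ([order_conditions_sufficient]).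
    The term O(h^4) of E' uses the fifth derivative of y.

    Necessity.  The coefficients above can be read off from the equations
    u''(t) = t^m v with zero initial data: there K_i = (c_i h)^m v exactly, and
    both errors are single powers of h times a defect of an order condition
    ([test_err], [test_err']).  A defect must vanish when the error is of higher
    order than its power of h ([order_condition_necessary]).  The case m = 1 gives
    the condition on sum b_i c_i and the case m = 2 the one on sum b'_i c_i^2.
    The remaining condition sum b'_i c_i = alpha^2/2, used in the sufficiency part,
    follows in the same way from uniform order two.

    Everything is proved for a set A of values of alpha contained in [0, 1]
    ([order3_iff]); uniform and discrete order are A = [0, 1] and A = {1}. *)

(** * Derivatives relative to a set *)

Section within_derivative.
Context {R : realType} {V : normedModType R}.
Implicit Types (A B : set R) (g : R -> V) (t : R).

(** Limits within A are unique at t because A contains an interval around or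
    next to t: this covers the end points, where derivatives are one-sided. *)
Lemma within_dnbhs_proper A (a b t : R) : a < b -> a <= t <= b ->
  `[a, b] `<=` A -> ProperFilter (within A t^').
Proof.
move=> ab /andP[at_ tb] abA; apply: Build_ProperFilter_ex.
move=> P /nbhs_ballP[e /= e0 eP].
have [tltb|blet] := ltP t b.
  exists (Num.min (t + e / 2) b); apply: eP.
  - rewrite /ball/= ltr_norml; apply/andP; split; rewrite /Num.min; case: ifP; lra.
  - by rewrite gt_eqF// lt_min tltb andbT ltrDl divr_gt0.
  - apply: abA; rewrite /= in_itv/= ge_min lexx orbT andbT le_min (ltW ab) andbT.
    by rewrite (le_trans at_)// lerDl divr_ge0// ltW.
exists (Num.max (t - e / 2) a).
have tb' : t = b by apply/eqP; rewrite eq_le tb blet.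
apply: eP.
- rewrite /ball/= ltr_norml; apply/andP; split; rewrite /Num.max; case: ifP; lra.
- have : Num.max (t - e / 2) a < t.
    by rewrite gt_max tb' ab andbT ltrBlDr ltrDl divr_gt0.
  by move/lt_eqF ->.
- apply: abA; rewrite /= in_itv/= le_max lexx orbT/= ge_max (ltW ab) andbT.
  by rewrite (le_trans _ tb)// gerBl divr_ge0// ltW.
Qed.

(** Derivatives are local; this is what allows the interval on which the solution
    is smooth to replace the half-line on which it satisfies the equation. *)
Lemma diff_quotient_local A B g1 g2 t :
  (\forall x \near t, (A x <-> B x) /\ (A x -> g1 x = g2 x)) -> g1 t = g2 t ->
  diff_quotient g1 t @ within A t^' = diff_quotient g2 t @ within B t^'.
Proof.
have sub (A1 B1 : set R) (f1 f2 : R -> V) :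
    (\forall x \near t, (B1 x -> A1 x /\ f1 x = f2 x)) -> f1 t = f2 t ->
    diff_quotient f1 t @ within A1 t^' `<=` diff_quotient f2 t @ within B1 t^'.
  move=> AB f12 W /= H.
  have {}H : \forall x \near t, x != t -> A1 x -> W (diff_quotient f1 t x) by exact: H.
  suff : \forall x \near t, x != t -> B1 x -> W (diff_quotient f2 t x) by [].
  apply: filterS2 AB H => x xAB H xt Bx; have [Ax fx] := xAB Bx.
  by have := H xt Ax; rewrite /diff_quotient f12 fx.
move=> AB g12; apply/seteqP; split; apply: sub => //.
- by apply: filterS AB => x [AB gx] Bx; split; [exact/AB|exact/gx/AB].
- by apply: filterS AB => x [AB gx] Ax; split; [exact/AB|exact/esym/gx].
Qed.

Lemma derive_within_cvg A g t v : ProperFilter (within A t^') ->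
  diff_quotient g t @ within A t^' --> v -> derive_within A g t = v.
Proof. by move=> PA; exact: cvg_lim. Qed.

Lemma derivable_within_cvg A g t : derivable_within A g t ->
  g @ within A (nbhs t) --> g t.
Proof.
move=> /cvgrPdist_lt Hl; apply/cvgrPdist_lt => e e0.
have := Hl 1 ltr01; set l := lim _ => /= {}Hl.
have k0 : 0 < e / (`|l| + 1) by rewrite divr_gt0// ltr_wpDl.
have H2 : \forall x \near t, `|t - x| < e / (`|l| + 1) by exact: nbhsx_ballx.
have {}Hl : \forall x \near t, x != t -> A x -> `|l - diff_quotient g t x| < 1 by exact: Hl.
suff : \forall x \near t, A x -> `|g t - g x| < e by [].
apply: filterS2 Hl H2 => x Hx tx Ax.
have [->|xt] := eqVneq x t; first by rewrite subrr normr0.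
have {}Hx := Hx xt Ax.
have -> : g t - g x = (t - x) *: diff_quotient g t x.
  rewrite /diff_quotient scalerA -[t - x]opprB mulNr mulfV ?subr_eq0//.
  by rewrite scaleN1r opprB.
rewrite normrZ.
have Hd : `|diff_quotient g t x| <= `|l| + 1.
  rewrite -[X in `|X| <= _](subrK l) addrC (le_trans (ler_normD _ _))// lerD2l.
  by rewrite distrC ltW.
rewrite (le_lt_trans (ler_wpM2l _ Hd))// -ltr_pdivlMr// ltr_wpDl//.
Qed.

Lemma derivable_within_interior (a b : R) g t : a < t < b ->
  derivable_within `[a, b] g t -> is_derive t 1 g (derive_within `[a, b] g t).
Proof.
move=> tab gt.
suff H : h^-1 *: ((g \o shift t) (h *: 1) - g t) @[h --> 0^'] -->
    derive_within `[a, b] g t.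
  by apply: DeriveDef; [apply/cvg_ex; exists (derive_within `[a, b] g t)|exact: cvg_lim].
apply: (@cvg_trans _ ((diff_quotient g t \o (fun h => h + t)) @ 0^')).
  by apply: near_eq_cvg; near=> h; rewrite /diff_quotient/= /GRing.scale/= mulr1 addrK.
apply: cvg_comp gt.
move=> W /=; rewrite /within/= /dnbhs/= /fmap/= => /nbhs_ballP[e /= e0 eW].
have /nbhs_ballP[e2 /= e20 eI] : \forall x \near t, x \in `]a, b[.
  by apply: near_in_itvoo; rewrite in_itv.
suff : \forall h \near (0 : R), h != 0 -> W (diff_quotient g t (h + t)) by [].
apply/nbhs_ballP; exists (Num.min e e2) => /=.
  by rewrite lt_min e0.
move=> h; rewrite /ball/= sub0r normrN lt_min => /andP[he he2] h0.
apply: eW; rewrite /ball/=.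
- by rewrite opprD addrCA subrr addr0 normrN.
- by apply: contra_neq h0 => /eqP; rewrite -subr_eq0 addrK => /eqP.
- have : h + t \in `]a, b[ by apply: eI; rewrite /ball/= opprD addrCA subrr addr0 normrN.
  by rewrite !in_itv/= => /andP[/ltW -> /ltW ->].
Unshelve. all: by end_near. Qed.

End within_derivative.

(** * Mean value inequality for curves in R^d *)

Section row_vectors.
Context {R : realType} {d : nat}.
Local Notation V := 'rV[R]_d.

Lemma row_norm_le (x : V) (c : R) : 0 <= c -> (forall j, `|x 0 j| <= c) -> `|x| <= c.
Proof.
move=> c0 xc; rewrite [leLHS]/Num.norm/= mx_normrE.
by apply: bigmax_le => // -[i j] _; rewrite /= (ord1 i).
Qed.

Lemma coord_norm_le (x : V) j : `|x 0 j| <= `|x|.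
Proof.
rewrite [leRHS]/Num.norm/= mx_normrE.
exact: (@le_bigmax _ _ _ 0 (fun ij => `|x ij.1 ij.2|) (0, j)).
Qed.

Lemma is_derive_coord (g : R -> V) (t : R) (v : V) j :
  is_derive t 1 g v -> is_derive t 1 (fun x => g x 0 j) (v 0 j).
Proof.
move=> [gt gv].
suff H : h^-1 *: (((fun x => g x 0 j) \o shift t) (h *: 1) - g t 0 j) @[h --> 0^'] --> v 0 j.
  by apply: DeriveDef; [apply/cvg_ex; exists (v 0 j)|exact: cvg_lim].
rewrite -gv.
have := cvg_comp _ _ gt (@coord_continuous R 1 d 0 j ('D_1 g t)).
apply: cvg_trans; apply: near_eq_cvg; near=> h.
by rewrite /= !mxE.
Unshelve. all: by end_near. Qed.

(** The scalar mean value theorem applied to each coordinate.  The power of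
    x - a lets Taylor remainders be bounded by iteration. *)
Lemma mean_value_le_pow (n : nat) (a b c : R) (g dg : R -> V) : 0 <= c ->
  {within `[a, b], continuous g} ->
  (forall x, a < x < b -> is_derive x 1 g (dg x)) ->
  (forall x, a < x < b -> `|dg x| <= c * (x - a) ^+ n) ->
  forall x, a <= x <= b -> `|g x - g a| <= c * (x - a) ^+ n.+1.
Proof.
move=> c0 gc gd dgc x /andP[ax xb].
have p0 : 0 <= c * (x - a) ^+ n.+1 by rewrite mulr_ge0// exprn_ge0// subr_ge0.
apply: row_norm_le => // j; rewrite !mxE.
have [<-|] := eqVneq a x; first by rewrite !subrr normr0 expr0n mulr0.
move=> /eqP/nesym/eqP; rewrite neq_lt ltNge ax/= => altx.
have := @MVT R (fun x => g x 0 j) (fun x => dg x 0 j) a x altx.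
case.
- move=> y; rewrite in_itv/= => /andP[ay yx]; apply: is_derive_coord; apply: gd.
  by rewrite ay (lt_le_trans yx).
- move=> y.
  apply: (@cvg_comp _ _ _ g (fun v : V => v 0 j)); last exact: coord_continuous.
  move: y; apply: continuous_subspaceW gc => y /=; rewrite !in_itv/= => /andP[-> /=].
  by move/le_trans; exact.
- move=> y; rewrite in_itv/= => /andP[ay yx] ->.
  rewrite normrM [`|x - a|]ger0_norm ?subr_ge0// exprSr mulrA.
  apply: ler_wpM2r; first by rewrite subr_ge0.
  apply: (le_trans (coord_norm_le _ _)).
  apply: (le_trans (dgc y _)); first by rewrite ay (lt_le_trans yx).
  apply: ler_wpM2l => //; apply: lerXn2r; rewrite ?nnegrE ?subr_ge0 ?ltW//.
  by rewrite ltrD2r.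
Qed.

End row_vectors.

(** * Equivalence of norms *)

Section norm_equivalence.
Context {R : realType} {d : nat}.
Local Notation V := 'rV[R]_d.
Variable N : vnorm R d.

Lemma vnorm_continuous : continuous (N : V -> R).
Proof.
have [K NK] := @vnorm_le R d N.
have NB (x y : V) : N x - N y <= N (x - y).
  by rewrite lerBlDr (le_trans _ (vnormD N _ _))// subrK.
move=> x; apply/(@cvgrPdist_le _ _ _ (nbhs (x : V)) _ N (N x)) => e e0; near=> y.
apply: (@le_trans _ _ (N (x - y))).
  rewrite ler_norml NB andbT lerNl opprB (le_trans (NB _ _))//.
  by rewrite -opprB -scaleN1r vnormZ normrN1 mul1r.
apply: (le_trans (NK _)).
apply: (@le_trans _ _ ((`|K| + 1) * `|x - y|)).
  by rewrite ler_wpM2r// ler_wpDr// ler_norm.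
rewrite -ler_pdivlMl ?ltr_wpDl// ltW//.
near: y; apply/nbhs_ballP; exists ((`|K| + 1)^-1 * e) => /=.
  by rewrite mulr_gt0// invr_gt0 ltr_wpDl.
by move=> y; rewrite -ball_normE.
Unshelve. all: by end_near. Qed.

(** The continuous function 1/N is bounded on the unit sphere, which is
    compact. *)
Lemma vnorm_ge : exists2 K, 0 < K & forall x : V, `|x| <= K * N x.
Proof.
pose S := [set x : V | `|x| = 1].
have cS : compact S.
  apply: bounded_closed_compact.
    by exists 1; split => // M M1 x /= ->; exact: ltW.
  apply: (@closed_comp _ _ (fun x : V => `|x|) [set 1]).
    by move=> x _; exact: norm_continuous.
  exact: closed_eq.
have cN : {within S, continuous (fun x : V => (N x)^-1)}.
  apply/subspace_continuousP => x Sx; apply: cvgV; last first.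
    apply: cvg_trans (@vnorm_continuous x); apply: cvg_app; exact: cvg_within.
  apply/eqP => /vnorm_eq0 x0; move: Sx; rewrite /S/= x0 normr0 => /eqP.
  by rewrite eq_sym oner_eq0.
have [B [_ HB]] := compact_bounded (continuous_compact cN cS).
have K0 : 0 < `|B| + 1 by rewrite ltr_wpDl.
exists (`|B| + 1) => // x.
have [->|x0] := eqVneq x 0; first by rewrite normr0 mulr_ge0// ?vnorm_ge0// ltW.
have Nx : 0 < N x.
  rewrite lt_neqAle vnorm_ge0 andbT; apply/eqP => /esym/vnorm_eq0 E.
  by rewrite E eqxx in x0.
have BB : B < `|B| + 1 by rewrite (le_lt_trans (ler_norm _))// ltrDl.
have nx : 0 < `|x| by rewrite normr_gt0.
have : `|(N (`|x|^-1 *: x))^-1| <= `|B| + 1.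
  apply: (HB _ BB); exists (`|x|^-1 *: x) => //.
  by rewrite /S/= normrZ normfV normr_id mulVf// gt_eqF.
rewrite vnormZ !normfV normr_id normrM normfV normr_id [`|N x|]gtr0_norm//.
by rewrite invfM invrK ler_pdivrMr.
Qed.

End norm_equivalence.

(** * Taylor expansion *)

Section taylor.
Context {R : realType} {d : nat}.
Local Notation V := 'rV[R]_d.

(** Purely algebraic: p - p(t) = ('X - t) q with q(t) = p'(t), so the difference
    quotient is the continuous function q. *)
Lemma diff_quotient_horner (W : normedModType R) (A : set R) (p : {poly R}) (v : W) t :
  diff_quotient (fun x => p.[x] *: v) t @ within A t^' --> p^`().[t] *: v.
Proof.
have /factor_theorem[q qE] : root (p - p.[t]%:P) t.
  by rewrite /root hornerD hornerN hornerC subrr.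
have -> : p^`().[t] = q.[t].
  rewrite -[p](subrK p.[t]%:P) qE derivD derivC addr0 derivM hornerD hornerM.
  by rewrite !hornerE subrr mulr0 add0r derivXsubC hornerC mulr1.
have H : (fun x => q.[x] *: v) @ within A t^' --> q.[t] *: v.
  apply: cvgZr_tmp; apply: cvg_trans (@continuous_horner R q t).
  apply: cvg_app => P tP; rewrite /within/= /dnbhs/=.
  by apply: filterS tP => x ? ? ?.
apply: cvg_trans H; apply: near_eq_cvg.
suff : \forall x \near t, x != t -> A x ->
    q.[x] *: v = diff_quotient (fun x => p.[x] *: v) t x by [].
near=> x => xt Ax; rewrite /diff_quotient -scalerBl scalerA.
have -> : p.[x] - p.[t] = (p - p.[t]%:P).[x] by rewrite hornerD hornerN hornerC.
by rewrite qE hornerM hornerXsubC mulrCA mulVf ?mulr1// subr_eq0.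
Unshelve. all: by end_near. Qed.

Lemma is_derive_hornerZ (p : {poly R}) (v : V) x :
  is_derive x (1 : R) (fun t => p.[t] *: v) (p^`().[x] *: v).
Proof.
have xI : x - 1 < x < x + 1 by rewrite ltrBlDr ltrDl ltr01.
have ab : x - 1 < x + 1 by case/andP: xI; exact: lt_trans.
have HD := @diff_quotient_horner V `[x - 1, x + 1] p v x.
have <- : derive_within `[x - 1, x + 1] (fun t => p.[t] *: v) x = p^`().[x] *: v.
  apply: derive_within_cvg HD; apply: (within_dnbhs_proper ab _ (@subset_refl _ _)).
  by case/andP: xI => /ltW -> /ltW ->.
by apply: derivable_within_interior => //; apply/cvg_ex; eexists; exact: HD.
Qed.

Definition taylor_basis (a : R) (j : nat) : {poly R} :=
  (j`!%:R)^-1 *: ('X - a%:P) ^+ j.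

Lemma horner_taylor_basis a j x :
  (taylor_basis a j).[x] = (x - a) ^+ j / j`!%:R.
Proof. by rewrite /taylor_basis !hornerE mulrC. Qed.

Lemma deriv_taylor_basis a j : (taylor_basis a j.+1)^`() = taylor_basis a j.
Proof.
rewrite /taylor_basis derivZ deriv_exp derivXsubC mul1r -scalerMnr scalerMnl.
by rewrite -mulr_natr factS natrM invfM mulrAC mulVf ?mul1r// pnatr_eq0.
Qed.

Definition taylor_poly (D : nat -> R -> V) a n i x : V :=
  \sum_(j < n.+1) (taylor_basis a j).[x] *: D (i + j)%N a.

(** Induction on n: the derivative of the remainder of order n+1 of D i is the
    remainder of order n of D (i+1), and remainders vanish at a.  The bound c is the
    same for all orders because every derivative up to m is bounded by c. *)
Lemma taylor_remainder_le (m : nat) (a b c : R) (D : nat -> R -> V) : 0 <= c ->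
  (forall i, (i < m)%N -> {within `[a, b], continuous (D i)}) ->
  (forall i x, (i < m)%N -> a < x < b -> is_derive x 1 (D i) (D i.+1 x)) ->
  (forall i x, (i <= m)%N -> a <= x <= b -> `|D i x| <= c) ->
  forall n i x, (i + n < m)%N -> a <= x <= b ->
    `|D i x - taylor_poly D a n i x| <= c * (x - a) ^+ n.+1.
Proof.
move=> c0 Dc Dd Db n; elim: n => [|n IH] i x im xab.
  rewrite /taylor_poly big_ord1 horner_taylor_basis fact0 expr0 mul1r invr1 scale1r addn0.
  rewrite addn0 in im; apply: (@mean_value_le_pow _ _ 0 a b c _ (D i.+1)) => //.
  - exact: Dc.
  - by move=> y; exact: Dd.
  - by move=> y /andP[ay yb]; rewrite expr0 mulr1; apply: Db => //; rewrite !ltW.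
have hT (k : nat) (y : R) :
    is_derive y (1 : R) (taylor_poly D a n.+1 k) (taylor_poly D a n k.+1 y).
  rewrite /taylor_poly.
  have -> : (fun x0 => \sum_(j < n.+2) (taylor_basis a j).[x0] *: D (k + j)%N a) =
      \sum_(j < n.+2) (fun x0 => (taylor_basis a j).[x0] *: D (k + j)%N a).
    by apply/funext => z; rewrite fct_sumE.
  have -> : \sum_(j < n.+1) (taylor_basis a j).[y] *: D (k.+1 + j)%N a =
     \sum_(j < n.+2) (taylor_basis a j)^`().[y] *: D (k + j)%N a.
    have T0 : (taylor_basis a 0)^`() = 0 by rewrite /taylor_basis expr0 derivZ derivC scaler0.
    rewrite [RHS]big_ord_recl /= T0 horner0 scale0r add0r; apply: eq_bigr => j _.
    by rewrite deriv_taylor_basis /= /bump/= add1n addSnnS.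
  by apply: is_derive_sum => j; exact: is_derive_hornerZ.
have gdc : forall k, (k < m)%N ->
    {within `[a, b], continuous (fun y => D k y - taylor_poly D a n.+1 k y)}.
  move=> k km y; apply: cvgB; first exact: Dc.
  apply: continuous_subspaceT => {}y; apply: differentiable_continuous.
  by apply/derivable1_diffP; have [] := hT k y.
have Ta : taylor_poly D a n.+1 i a = D i a.
  rewrite /taylor_poly big_ord_recl horner_taylor_basis subrr expr0 fact0 mul1r invr1.
  rewrite scale1r addn0 big1 ?addr0// => j _.
  by rewrite horner_taylor_basis subrr expr0n/= mul0r scale0r.
have := @mean_value_le_pow R d n.+1 a b c (fun y => D i y - taylor_poly D a n.+1 i y)
  (fun y => D i.+1 y - taylor_poly D a n i.+1 y) c0
  (gdc i (leq_ltn_trans (leq_addr _ _) im)) _ _ x xab.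
rewrite Ta subrr subr0; apply.
  move=> y yab; apply: (is_deriveB _ (hT i y)).
  by apply: Dd => //; apply: leq_ltn_trans im; exact: leq_addr.
move=> y /andP[ay yb]; apply: IH; last by rewrite !ltW.
by rewrite addSnnS.
Qed.

Lemma taylor_poly2 (D : nat -> R -> V) a i t :
  taylor_poly D a 2 i (a + t) =
    D i a + t *: D i.+1 a + (t ^+ 2 / 2) *: D i.+2 a.
Proof.
rewrite /taylor_poly !big_ord_recl big_ord0 !horner_taylor_basis /= /bump/=.
rewrite [a + t]addrC addrK !add1n addn0 addn1 addn2 !divr1 expr0 expr1 scale1r.
by rewrite addr0 addrA.
Qed.

Lemma taylor_poly3 (D : nat -> R -> V) a i t :
  taylor_poly D a 3 i (a + t) =
    D i a + t *: D i.+1 a + (t ^+ 2 / 2) *: D i.+2 a + (t ^+ 3 / 6) *: D i.+3 a.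
Proof.
rewrite /taylor_poly !big_ord_recl big_ord0 !horner_taylor_basis /= /bump/=.
rewrite [a + t]addrC addrK !add1n addn0 addn1 addn2 addn3 !divr1 expr0 expr1 scale1r.
by rewrite addr0 !addrA.
Qed.

End taylor.

(** * Functions of class C^k on a closed interval *)

Section class_C_theory.
Context {R : realType} {d : nat}.
Local Notation V := 'rV[R]_d.

Lemma derivable_within_itv_continuous (a b : R) (g : R -> V) :
  (forall t, a <= t <= b -> derivable_within `[a, b] g t) ->
  {within `[a, b], continuous g}.
Proof.
move=> dg; apply/subspace_continuousP => x; rewrite /= in_itv/= => /dg.
exact: derivable_within_cvg.
Qed.

Lemma class_C_continuous k (a b : R) (g : R -> V) i : (i <= k)%N ->
  class_C k `[a, b] g ->
  {within `[a, b], continuous (iter i (derive_within `[a, b]) g)}.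
Proof.
move=> + [dg cg]; rewrite leq_eqVlt => /predU1P[->//|ik].
apply: derivable_within_itv_continuous => t tab.
by apply: dg => //=; rewrite in_itv.
Qed.

Lemma class_C_bounded k (a b : R) (g : R -> V) : class_C k `[a, b] g ->
  exists2 c, 0 <= c & forall i x, (i <= k)%N -> a <= x <= b ->
    `|iter i (derive_within `[a, b]) g x| <= c.
Proof.
move=> gC.
have H i : exists c, (i <= k)%N -> forall x, a <= x <= b ->
    `|iter i (derive_within `[a, b]) g x| <= c.
  have [ik|_] := leqP i k; last by exists 0.
  have [c [_ cP]] := compact_bounded (continuous_compact (class_C_continuous ik gC)
    (@segment_compact R a b)).
  exists (c + 1) => _ x xab; apply: (cP (c + 1)); first by rewrite ltrDl.
  by exists x => //=; rewrite in_itv.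
have [c cP] := choice H.
exists (\sum_(i < k.+1) `|c i|); first exact: sumr_ge0.
move=> i x ik xab; apply: (le_trans (cP i ik x xab)); apply: (le_trans (ler_norm _)).
have ik' : (i < k.+1)%N by [].
by rewrite (bigD1 (Ordinal ik'))//= lerDl sumr_ge0.
Qed.

Lemma class_C_taylor m (a b : R) (g : R -> V) : a < b -> class_C m `[a, b] g ->
  exists2 c, 0 <= c & forall n i x, (i + n < m)%N -> a <= x <= b ->
    `|iter i (derive_within `[a, b]) g x -
      taylor_poly (fun i => iter i (derive_within `[a, b]) g) a n i x| <=
    c * (x - a) ^+ n.+1.
Proof.
move=> ab gC; have [c c0 cP] := class_C_bounded gC; exists c => // n i x.
apply: taylor_remainder_le => //.
- by move=> j jm; apply: class_C_continuous gC; exact: ltnW.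
- move=> j y jm yab; apply: derivable_within_interior => //.
  by apply: gC.1 => //=; rewrite in_itv/=; case/andP: yab => /ltW -> /ltW ->.
Qed.

(** Break points are locally finite, so none of those after a is close to a. *)
Lemma piecewise_class_C_start k (J : set R) (g : R -> V) (a b : R) : a < b ->
  `[a, b] `<=` J -> piecewise_class_C k J g ->
  exists2 e, a < e <= b & class_C k `[a, e] g.
Proof.
move=> ab abJ [B [Bfin BC]].
have cB : closed ((B `&` `[a, b]) `\ a).
  apply: (iffLR accessible_finite_set_closed (hausdorff_accessible (@Rhausdorff R))).
  by apply: finite_setD; exact: Bfin.
have /nbhs_ballP[e /= e0 eB] : nbhs a (~` ((B `&` `[a, b]) `\ a)).
  by apply: open_nbhs_nbhs; split; [exact: closed_openC|move=> [_]; exact].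
exists (Num.min b (a + e)).
  by rewrite lt_min ab ltrDl e0 ge_min lexx.
apply: BC.
- by rewrite lt_min ab ltrDl.
- move=> x; rewrite /= in_itv/= le_min => /and3P[ax xb _].
  by apply: abJ; rewrite /= in_itv/= ax.
- apply/seteqP; split => // x [Bx]; rewrite /= in_itv/= lt_min => /and3P[ax xb xe].
  apply: (eB x); first by rewrite /ball/= ltr_norml; lra.
  split; first by split => //=; rewrite in_itv/= !ltW.
  by move=> xa; move: ax; rewrite xa ltxx.
Qed.

End class_C_theory.

(** * Local expansion of the solution *)

Section solution_expansion.
Context {R : realType} {d : nat} {N : vnorm R d} {r : \bar R}.
Hypothesis hr : (0 <= r)%E.
Variable P : ivp N r.
Local Notation V := 'rV[R]_d.
Local Notation J := (forward_set (sigma P) (tend P)).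

Lemma delay_set0 : delay_set r 0.
Proof. by split; rewrite //= leeNl oppe0. Qed.

Lemma sol_phi th : delay_set r th -> sol P (sigma P + th) = phi P th.
Proof. by have [[_ [_ H] _ _] _] := ivp_sol P; exact: H. Qed.

Lemma derive_sol_sigma : derive_within J (sol P) (sigma P) = slope P.
Proof. by have [[]] := ivp_sol P. Qed.

Lemma sol_eqn t : J t ->
  [/\ dom P (t, segment N r (fun th => sol P (t + th))),
    derivable_within J (sol P) t &
    derive_within J (derive_within J (sol P)) t =
      rhs P (t, segment N r (fun th => sol P (t + th)))].
Proof. by have [[_ _ _ H] _] := ivp_sol P; move=> /H[]. Qed.

Lemma forward_start : exists2 e, 0 < e & `[sigma P, sigma P + e] `<=` J.
Proof.
have [[sT _ _ _] _] := ivp_sol P.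
have [e e0 eT] : exists2 e, 0 < e & ((sigma P + e)%:E < tend P)%E.
  move: sT; case: (tend P) => [T| |]//=; last by exists 1; rewrite ?ltry.
  rewrite lte_fin => sT; exists ((T - sigma P) / 2); first by rewrite divr_gt0// subr_gt0.
  by rewrite lte_fin; lra.
exists e => // t; rewrite /= in_itv/= => /andP[st te]; split => //.
by rewrite (le_lt_trans _ eT)// lee_fin.
Qed.

Lemma forward_set_sub : J `<=` sol_set P.
Proof.
move=> t [st tT]; split => //.
apply: (@le_trans _ _ (sigma P)%:E); last by rewrite lee_fin.
by rewrite -[leRHS]adde0 leeD2l// leeNl oppe0.
Qed.

(** The derivatives of [class_C] are relative to an interval [sigma, b], those of
    the equation to the forward set.  They agree before b; halving the interval
    keeps all the points away from b. *)
Lemma sol_expansion : piecewise_class_C 5 (sol_set P) (sol P) ->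
  exists e c (y2 y3 y4 : V), [/\ 0 < e, 0 <= c,
    {within `[sigma P, sigma P + e], continuous (sol P)} &
    forall t, 0 <= t <= e -> [/\ J (sigma P + t),
    `|sol P (sigma P + t) -
      (phi P 0 + t *: slope P + (t ^+ 2 / 2) *: y2 + (t ^+ 3 / 6) *: y3)| <= c * t ^+ 4,
    `|derive_within J (sol P) (sigma P + t) -
      (slope P + t *: y2 + (t ^+ 2 / 2) *: y3 + (t ^+ 3 / 6) *: y4)| <= c * t ^+ 4 &
    `|derive_within J (derive_within J (sol P)) (sigma P + t) -
      (y2 + t *: y3 + (t ^+ 2 / 2) *: y4)| <= c * t ^+ 3]].
Proof.
move=> uC; set s := sigma P; set u := sol P.
have [e0 e00 e0J] := forward_start.
have se0 : s < s + e0 by rewrite ltrDl.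
have [b /andP[sb be0] uCb] :=
  piecewise_class_C_start se0 (subset_trans e0J forward_set_sub) uC.
have bJ t : s <= t < b -> \forall x \near t, J x <-> x \in `[s, b].
  move=> /andP[st tb]; near=> x; rewrite in_itv/=.
  have xb : x < b by near: x; exact: lt_nbhsl.
  split=> [[sx _]|/andP[sx _]]; first by rewrite sx ltW.
  by apply: e0J; rewrite /= in_itv/= sx (le_trans (ltW xb)).
pose D i := iter i (derive_within `[s, b]) u.
have D1 t : s <= t < b -> derive_within J u t = D 1%N t.
  by move=> /bJ H; rewrite /derive_within (@diff_quotient_local _ _ J `[s, b] u u)//;
     apply: filterS H => x.
have D2 t : s <= t < b -> derive_within J (derive_within J u) t = D 2%N t.
  move=> /[dup] st /bJ H; rewrite {1}/derive_within.
  rewrite (@diff_quotient_local _ _ J `[s, b] _ (D 1%N))//; last exact: D1.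
  have tb : t < b by case/andP: st.
  near=> x; split; first by near: x; exact: H.
  move=> [sx _]; apply: D1; rewrite sx/=; near: x; exact: lt_nbhsl.
have [c c0 cT] := class_C_taylor sb uCb.
pose e := (b - s) / 2.
have e_gt0 : 0 < e by rewrite divr_gt0// subr_gt0.
have seb : s + e < b by rewrite /e; lra.
exists e, c, (D 2%N s), (D 3%N s), (D 4%N s); split => //.
  apply: continuous_subspaceW (class_C_continuous (leq0n 5) uCb).
  move=> x; rewrite /= !in_itv/= => /andP[-> /=] /le_trans; apply; exact: ltW.
move=> t /andP[t0 te].
have st : s <= s + t < b by rewrite lerDl t0/= (le_lt_trans _ seb)// lerD2l.
have stb : s <= s + t <= b by case/andP: st => -> /ltW.
have u0 : u s = phi P 0 by rewrite -sol_phi ?addr0//; exact: delay_set0.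
have us : D 1%N s = slope P.
  by rewrite -derive_sol_sigma D1// lexx.
split.
- apply: e0J; rewrite /= in_itv/= lerDl t0/=.
  by rewrite (le_trans _ be0)//; case/andP: stb.
- by have := cT 3 0%N _ isT stb; rewrite taylor_poly3 [s + t - s]addrAC subrr add0r /= -us -u0.
- by have := cT 3 1%N _ isT stb; rewrite taylor_poly3 [s + t - s]addrAC subrr add0r D1 // -us.
- by have := cT 2 2%N _ isT stb; rewrite taylor_poly2 [s + t - s]addrAC subrr add0r D2.
Unshelve. all: by end_near. Qed.

End solution_expansion.

(** * Segments of functions that continue an initial function *)

Section segments.
Context {R : realType} {d : nat} {N : vnorm R d} {r : \bar R}.
Hypothesis hr : (0 <= r)%E.
Local Notation V := 'rV[R]_d.
Local Notation I := (delay_set r).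
Implicit Types (phi : phase N r) (w : R -> V).

(** Heine-Cantor on the part of the delay interval after M - 1, where M is chosen
    such that phi is within e/2 of its limit at -oo before M.  Two points at
    distance less than 1 are both before M or both after M - 1. *)
Lemma phase_unif_continuous phi (e : R) : 0 < e -> exists2 eta, 0 < eta &
  forall x y, I x -> I y -> `|x - y| < eta -> `|phi x - phi y| < e.
Proof.
move=> e0; have := phase_funP phi; rewrite inE => -[phic phil _].
have e20 : 0 < e / 2 by rewrite divr_gt0.
have [M [Mr HM]] := (iffLR (@cvgrPdist_lt _ _ _ _ _ _ _) phil) _ e20.
have cI : compact (I `&` `[M - 1, 0]).
  apply: (@subclosed_compact _ _ `[M - 1, 0]); last exact: subIsetr.
    apply: closedI; [exact: delay_set_closed|exact: interval_closed].
  exact: segment_compact.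
have phix x : I x -> \forall x' \near x, I x' -> `|phi x - phi x'| < e / 2.
  move=> Ix; move/subspace_continuousP: phic => /(_ x Ix)/cvgrPdist_lt/(_ _ e20).
  by [].
have cov : near_covering_within (I `&` `[M - 1, 0]).
  by apply/near_covering_withinP; apply/compact_near_coveringP.
have [|eta /= eta0 etaP] := cov R 0^'+
  (fun eta x => forall y, I y -> `|x - y| < eta -> `|phi x - phi y| < e) _.
- move=> x [Ix _].
  have /nbhs_ballP[k /= k0 kP] := phix x Ix.
  exists (ball x (k / 2), [set eta : R | eta < k / 2]).
    split=> /=; first by apply: nbhsx_ballx; rewrite divr_gt0.
    by apply: nbhs_right_lt; rewrite divr_gt0.
  move=> [x' eta] /= [xx' etak] [Ix' _] y Iy x'y.
  have h1 : `|phi x - phi x'| < e / 2.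
    by apply: kP => //; by apply: le_ball xx'; move: (k : R) k0 => ? ?; lra.
  have h2 : `|phi x - phi y| < e / 2.
    apply: kP => //; rewrite /ball/= -[x - y](subrKA x').
    rewrite (le_lt_trans (ler_normD _ _))// [k]splitr ltrD//.
    exact: lt_trans x'y _.
  rewrite -[_ - _](subrKA (phi x)) (le_lt_trans (ler_normD _ _))// [e]splitr ltrD//.
  by rewrite distrC.
exists (Num.min (eta / 2) 1); first by rewrite lt_min ltr01 divr_gt0.
have eta2 : `|0 - eta / 2| < eta.
  by rewrite sub0r normrN gtr0_norm ?divr_gt0// ltr_pdivrMr// ltr_pMr// ltr1n.
have eta20 : 0 < eta / 2 by rewrite divr_gt0.
move=> x y Ix Iy; rewrite lt_min => /andP[xy1 xy2].
have [xM|Mx] := ltP x M; have [yM|My] := ltP y M.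
- rewrite -[_ - _](subrKA (lim (phi x @[x --> -oo]))) (le_lt_trans (ler_normD _ _))//.
  by rewrite [e]splitr ltrD//; [rewrite distrC|]; exact: HM.
all: apply: (etaP (eta / 2)) => //; split => //; rewrite /= in_itv/= ?Ix.2 ?Iy.2 andbT.
all: by move: xy2; rewrite ltr_norml; lra.
Qed.

(** Both the solution and the stage functions, shifted to start at time 0, are of
    this form. *)
Definition continues phi w (tau : R) : Prop :=
  (forall x, I x -> w x = phi x) /\ {within `[0, tau], continuous w}.

Lemma continues_le phi w (tau tau' : R) : tau' <= tau ->
  continues phi w tau -> continues phi w tau'.
Proof.
move=> tt [wphi wc]; split => //; apply: continuous_subspaceW wc => x.
by rewrite /= !in_itv/= => /andP[-> /=] /le_trans; exact.
Qed.

Lemma delay_set_shift (tau th : R) : 0 <= tau -> I th -> tau + th <= 0 -> I (tau + th).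
Proof.
by move=> tau0 [rth _] ?; split => //; rewrite (le_trans rth)// lee_fin lerDr.
Qed.

Lemma patch_delay_out w th : ~ I th -> (w \_ I) th = 0.
Proof. by move=> nI; rewrite patchE memNset//; apply/matrixP => i j; rewrite !mxE. Qed.

(** Makes segments genuine elements of the phase space, rather than the default
    value of [segment]. *)
Lemma phase_pred_segment phi w (tau : R) : 0 <= tau -> continues phi w tau ->
  (fun th => w (tau + th)) \_ I \in @phase_pred R d r.
Proof.
move=> tau0 [wphi wc]; have := phase_funP phi; rewrite inE => -[phic phil phi0].
rewrite inE; split; last by move=> th; exact: patch_delay_out.
- apply: (@subspace_eq_continuous _ _ _ (fun th => w (tau + th))).
    by move=> x xI; rewrite /from_subspace patchE xI.
  have wI : {within I, continuous w}.
    by apply: subspace_eq_continuous phic => x; rewrite inE => /wphi.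
  have wU : {within I `|` `[0, tau], continuous w}.
    apply: withinU_continuous wI wc; first exact: delay_set_closed.
    exact: interval_closed.
  apply/subspace_continuousP => th Ith.
  have U : (I `|` `[0, tau]) (tau + th).
    have [le0|gt0] := leP (tau + th) 0; first by left; exact: delay_set_shift.
    by right; rewrite /= in_itv/= (ltW gt0) gerDl; exact: Ith.2.
  move/subspace_continuousP : wU => /(_ _ U); apply: cvg_comp.
  move=> A /= /nbhs_ballP[e /= e0 eA].
  suff : \forall x \near th, I x -> A (tau + x) by [].
  apply/nbhs_ballP; exists e => //= x thx Ix; apply: eA.
    by rewrite /ball/= opprD addrACA subrr add0r.
  have [le0|gt0] := leP (tau + x) 0; first by left; exact: delay_set_shift.
  by right; rewrite /= in_itv/= (ltW gt0) gerDl; exact: Ix.2.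
- have sh : cvg (phi (tau + x) @[x --> -oo]).
    apply/cvg_ex; exists (lim (phi x @[x --> -oo])).
    apply: (@cvg_comp _ _ _ (fun x => tau + x) phi _ (nbhs -oo)) phil.
    move=> A [M [Mr MA]]; exists (M - tau); split; first by rewrite num_real.
    by move=> x xM; apply: MA; rewrite -ltrBrDl.
  have [M HM] : exists M : R, forall x, x < M ->
      ((fun th => w (tau + th)) \_ I) x = phi (tau + x).
    have [[a Ia]|Ia] : (exists a : R, forall x, I x -> - a <= x) \/ (forall x, x <= 0 -> I x).
      rewrite /delay_set; move: hr; case: (r) => [a| |]//= _.
        by left; exists a => x -[]; rewrite lee_fin.
      by right => x x0; split; rewrite ?leNye.
    + exists (- a - tau) => x xa; rewrite patch_delay_out; last by move=> /Ia; lra.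
      by rewrite phi0// => /Ia; lra.
    + exists (- tau) => x xa; rewrite patchE mem_set; last by apply: Ia; lra.
      by apply: wphi; apply: Ia; lra.
  apply/cvg_ex; exists (lim (phi (tau + x) @[x --> -oo])).
  apply: cvg_trans sh; apply: near_eq_cvg.
  by exists M; split; [rewrite num_real|move=> x /HM ->].
Qed.

Lemma segment_val phi w (tau : R) th : 0 <= tau -> continues phi w tau -> I th ->
  segment N r (fun x => w (tau + x)) th = w (tau + th).
Proof.
move=> tau0 cw Ith.
have /(congr1 (fun f => f th)) := insubdK (0 : phase N r) (phase_pred_segment tau0 cw).
by rewrite /= patchE mem_set// => <-.
Qed.

Lemma segment_dist_le phi w1 w2 (tau c : R) : 0 <= tau -> 0 <= c ->
  continues phi w1 tau -> continues phi w2 tau ->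
  (forall x, 0 <= x <= tau -> N (w1 x - w2 x) <= c) ->
  `|segment N r (fun x => w1 (tau + x)) - segment N r (fun x => w2 (tau + x))| <= c.
Proof.
move=> tau0 c0 cw1 cw2 H; apply: phase_norm_le => // th Ith.
rewrite [X in N X](_ : _ = w1 (tau + th) - w2 (tau + th)); last first.
  by rewrite -(segment_val tau0 cw1 Ith) -(segment_val tau0 cw2 Ith).
have [le0|gt0] := leP (tau + th) 0.
  have It := delay_set_shift tau0 Ith le0.
  by rewrite cw1.1// cw2.1// subrr vnorm0.
by apply: H; rewrite (ltW gt0) gerDl; exact: Ith.2.
Qed.

(** Continuity at 0 of t |-> w_t.  For tau + th <= 0 the two values of phi are
    tau apart; otherwise both points are within tau of 0, and w(0) = phi(0) serves
    as intermediate value. *)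
Lemma segment_near_initial phi w (e delta : R) : 0 < e -> 0 < delta ->
  continues phi w delta -> exists2 eta, 0 < eta &
  forall tau, 0 <= tau <= eta -> `|segment N r (fun x => w (tau + x)) - phi| <= e.
Proof.
move=> e0 delta0 cw.
have [K NK] := @vnorm_le R d N.
have K0 : 0 < `|K| + 1 by rewrite ltr_wpDl.
(* N <= K |.|, and two errors of size e' are added. *)
pose e' := e / (`|K| + 1) / 2.
have e'0 : 0 < e' by rewrite !divr_gt0.
have Ne (x : V) : `|x| <= e' + e' -> N x <= e.
  move=> xe; rewrite (le_trans (NK x))//.
  rewrite (@le_trans _ _ ((`|K| + 1) * `|x|))//.
    by rewrite ler_wpM2r// ler_wpDr// ler_norm.
  by rewrite -ler_pdivlMl// mulrC (le_trans xe)// -splitr.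
have [eta1 eta10 H1] := phase_unif_continuous phi e'0.
have [eta2 eta20 H2] : exists2 eta2, 0 < eta2 &
    forall x, 0 <= x -> x <= delta -> x < eta2 -> `|w 0 - w x| < e'.
  have d0 : [set` `[0, delta]] 0 by rewrite /= in_itv/= lexx ltW.
  have /cvgrPdist_lt/(_ _ e'0) := iffLR (subspace_continuousP _ _) cw.2 0 d0.
  move=> /nbhs_ballP[eta2 /= eta20 H2]; exists eta2 => // x x0 xd xe.
  apply: H2; last by rewrite /= in_itv/= x0.
  by rewrite /ball/= sub0r normrN ger0_norm.
(* Halved because the moduli are strict bounds whereas tau <= eta. *)
pose eta := Num.min delta (Num.min (eta1 / 2) (eta2 / 2)).
exists eta; first by rewrite !lt_min delta0 !divr_gt0.
move=> tau /andP[tau0]; rewrite !le_min => /and3P[td t1 t2].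
have cwt := continues_le td cw.
apply: phase_norm_le => [|th Ith]; first exact: ltW.
rewrite [X in N X](_ : _ = w (tau + th) - phi th); last first.
  by rewrite -(segment_val tau0 cwt Ith).
apply: Ne; have [le0|gt0] := leP (tau + th) 0.
  have It := delay_set_shift tau0 Ith le0.
  rewrite cw.1// (le_trans (ltW (H1 _ _ It Ith _)))//; last by rewrite lerDl ltW.
  by rewrite addrK ger0_norm//; lra.
rewrite -[_ - _](subrKA (w 0)) (le_trans (ler_normD _ _))// lerD//.
  have := Ith.2 => /= ?; rewrite distrC ltW// H2//; lra.
have I0 := @delay_set0 R r hr.
rewrite cw.1// ltW// H1// sub0r normrN ler0_norm; last exact: Ith.2.
lra.
Qed.

End segments.

(** * Lipschitz estimate for the right-hand side *)

Section segments_in_normed_modules.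
Context {R : realType} {d : nat} {W : normedModType R}.
Local Notation V := 'rV[R]_d.
Implicit Types (p q : W) (x c e : R).

(** Balls are convex. *)
Lemma segment_in_ball p1 p2 q x e : 0 <= x <= 1 ->
  `|p1 - q| < e -> `|p2 - q| < e -> `|p2 + x *: (p1 - p2) - q| < e.
Proof.
move=> /andP[x0 x1] ae be.
have -> : p2 + x *: (p1 - p2) - q = x *: (p1 - q) + (1 - x) *: (p2 - q).
  have -> : p1 - p2 = (p1 - q) - (p2 - q) by rewrite opprB addrA subrK.
  by rewrite addrAC scalerBr scalerBl scale1r addrCA.
rewrite (le_lt_trans (ler_normD _ _))// !normrZ !ger0_norm ?subr_ge0//.
move: `|p1 - q| `|p2 - q| ae be => a b ae be.
have [ab|/ltW ba] := leP a b.
  apply: le_lt_trans be; suff : 0 <= x * (b - a) by lra.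
  by rewrite mulr_ge0 ?subr_ge0.
apply: le_lt_trans ae; suff : 0 <= (1 - x) * (a - b) by lra.
by rewrite mulr_ge0 ?subr_ge0.
Qed.

(** The mean value inequality for x |-> F (p2 + x (p1 - p2)) on [0, 1]. *)
Lemma mean_value_segment (F : W -> V) p1 p2 c :
  (forall x, 0 <= x <= 1 -> differentiable F (p2 + x *: (p1 - p2)) /\
    `|'d F (p2 + x *: (p1 - p2)) (p1 - p2)| <= c) ->
  `|F p1 - F p2| <= c.
Proof.
move=> dF; set chi := p1 - p2 in dF.
pose g x := F (p2 + x *: chi).
have gd x : 0 <= x <= 1 ->
    is_derive x (1 : R) g ('d F (p2 + x *: chi) chi).
  move=> /dF[Fd _].
  have := (@diff_derivable _ _ _ _ _ chi Fd); rewrite /derivable; set q := (X in cvg (X @ _)).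
  have qE : q = fun h : R => h^-1 *: ((g \o shift x) (h *: 1) - g x).
    apply/funext => h; rewrite /q /g /=; congr (_ *: (F _ - _)).
    by rewrite -[h%:A]/(h * 1) mulr1 scalerDl addrCA.
  rewrite qE => H; apply: DeriveDef; first exact: H.
  have <- : 'D_chi F (p2 + x *: chi) = 'd F (p2 + x *: chi) chi by exact: deriveE.
  by rewrite [RHS](_ : _ = lim (q @ 0^')) // qE.
have gc : {within `[0, 1], continuous g}.
  have := @derivable_within_continuous _ _ g `[0, 1]%R; apply.
  by move=> x; rewrite in_itv/= => /gd[].
have gb x : 0 < x < 1 -> `|'d F (p2 + x *: chi) chi| <= c * (x - 0) ^+ 0.
  move=> /andP[x0 x1]; rewrite expr0 mulr1.
  have [|_ H] := dF x; first by rewrite (ltW x0) (ltW x1).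
  exact: H.
have c0 : 0 <= c.
  have [|_] := dF 0; first by rewrite lexx ler01.
  by apply: le_trans.
have := @mean_value_le_pow R d 0 0 1 c g _ c0 gc _ gb 1.
rewrite /g scale1r scale0r addr0 /chi [p2 + _]addrC subrK subr0 expr1 mulr1; apply.
- by move=> x /andP[x0 x1]; apply: gd; rewrite !ltW.
- by rewrite ler01 lexx.
Qed.

End segments_in_normed_modules.

Section lipschitz.
Context {R : realType} {d : nat} {N : vnorm R d} {r : \bar R}.
Local Notation V := 'rV[R]_d.
Local Notation C := (phase N r).

(** The domain need not be convex, so the estimate is confined to a ball around
    (s, phi) inside it. *)
Lemma rhs_lipschitz (Omega : set (R * C)) (f : R * C -> V) (s : R) (phi : C) :
  rfde Omega f -> Omega (s, phi) ->
  exists e L : R, [/\ 0 < e, 0 <= L & forall t psi1 psi2, `|t - s| < e ->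
    `|psi1 - phi| < e -> `|psi2 - phi| < e ->
    `|f (t, psi1) - f (t, psi2)| <= L * `|psi1 - psi2| ].
Proof.
move=> [oO _ fC1 [M fM]] Osphi.
have [e e0 eO] : exists2 e : R, 0 < e &
    forall t psi, `|t - s| < e -> `|psi - phi| < e -> Omega (t, psi).
  have /nbhs_ballP[e /= e0 eO] : nbhs (s, phi) Omega by apply: open_nbhs_nbhs; split.
  exists e => // t psi ts pp; apply: eO; split => /=; rewrite -ball_normE /ball_/= distrC//.
have [K K0 NK] := vnorm_ge N.
exists e, (K * `|M|); split => //; first by rewrite mulr_ge0// ltW.
move=> t p1 p2 ts p1e p2e.
apply: (@mean_value_segment _ _ C (fun psi => f (t, psi))) => x x01.
have px := eO _ _ ts (segment_in_ball x01 p1e p2e).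
split; first by have [] := fC1 _ _ px.
apply: (le_trans (NK _)); rewrite -mulrA ler_pM2l//.
apply: (le_trans (fM _ (p1 - p2) px)).
apply: ler_wpM2r; [exact: normr_ge0|exact: ler_norm].
Qed.

End lipschitz.

(** * Uniform O(h^n) estimates *)

Section bigO.
Context {R : realType} {V : normedModType R} {X : Type}.
Implicit Types (A : set X) (F G : R -> X -> V) (n : nat).

Definition bigO A n F : Prop := exists h0 c : R, [/\ 0 < h0, 0 <= c &
  forall h x, 0 < h <= h0 -> A x -> `|F h x| <= c * h ^+ n].

Lemma bigO_ext A n F G : (forall h x, 0 < h -> A x -> F h x = G h x) ->
  bigO A n F -> bigO A n G.
Proof.
move=> FG [h0 [c [h00 c0 H]]]; exists h0, c; split => // h x hh Ax.
by rewrite -FG ?H//; case/andP: hh.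
Qed.

Lemma bigOD A n F G : bigO A n F -> bigO A n G -> bigO A n (fun h x => F h x + G h x).
Proof.
move=> [h1 [c1 [h10 c10 H1]]] [h2 [c2 [h20 c20 H2]]].
exists (Num.min h1 h2), (c1 + c2); split; [by rewrite lt_min h10|exact: addr_ge0|].
move=> h x /andP[h0]; rewrite le_min => /andP[hh1 hh2] Ax.
by rewrite (le_trans (ler_normD _ _))// mulrDl lerD// ?H1 ?H2// h0.
Qed.

Lemma bigO0 A n : bigO A n (fun _ _ => 0).
Proof. by exists 1, 0; split => // h x _ _; rewrite normr0 mul0r. Qed.

Lemma bigO_sum A n (I : Type) (s : seq I) (Q : pred I) (F : I -> R -> X -> V) :
  (forall i, Q i -> bigO A n (F i)) -> bigO A n (fun h x => \sum_(i <- s | Q i) F i h x).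
Proof.
move=> H; elim: s => [|i s IH].
  by apply: bigO_ext (bigO0 A n) => h x _ _; rewrite big_nil.
have [Qi|nQi] := boolP (Q i).
  by apply: bigO_ext (bigOD (H i Qi) IH) => h x _ _; rewrite big_cons Qi.
by apply: bigO_ext IH => h x _ _; rewrite big_cons (negbTE nQi).
Qed.

Lemma bigO_scale A n (a : X -> R) m F : (forall x, A x -> `|a x| <= m) ->
  bigO A n F -> bigO A n (fun h x => a x *: F h x).
Proof.
move=> am [h0 [c [h00 c0 H]]]; exists h0, (`|m| * c).
split => //; first by rewrite mulr_ge0.
move=> h x hh Ax; rewrite normrZ -mulrA ler_pM// ?H//.
by rewrite (le_trans (am x Ax))// ler_norm.
Qed.

Lemma bigO_pow A n k F : bigO A n F -> bigO A (k + n) (fun h x => h ^+ k *: F h x).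
Proof.
move=> [h0 [c [h00 c0 H]]]; exists h0, c; split => // h x hh Ax.
have h_ge0 : 0 <= h by case/andP: hh => /ltW.
by rewrite normrZ ger0_norm ?exprn_ge0// exprD mulrCA ler_wpM2l ?exprn_ge0// H.
Qed.

Lemma bigO_weak A n m F : (m <= n)%N -> bigO A n F -> bigO A m F.
Proof.
move=> mn [h0 [c [h00 c0 H]]]; exists (Num.min h0 1), c.
split => //; first by rewrite lt_min h00 ltr01.
move=> h x /andP[hp]; rewrite le_min => /andP[hh0 h1] Ax.
rewrite (le_trans (H _ _ _ Ax)) ?hp// ler_wpM2l//.
by rewrite ler_wiXn2l// ltW.
Qed.

Lemma bigO_const A (v : V) : bigO A 0 (fun _ _ => v).
Proof. by exists 1, `|v|; split => // h x _ _; rewrite expr0 mulr1. Qed.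

End bigO.

Lemma horner_bounded (R : realType) (p : {poly R}) (a b : R) :
  exists m, forall x, a <= x <= b -> `|p.[x]| <= m.
Proof.
have [m mP] := poly_itv_bound p a b; exists m => x /andP[ax xb].
by rewrite mP ?ax.
Qed.

(** * Stages and local errors *)

Lemma bigO_rescale (R : realType) (V : normedModType R) (g : R -> V) (e c m : R) n :
  0 < e -> 0 <= c -> 0 <= m -> (forall t, 0 <= t <= e -> `|g t| <= c * t ^+ n) ->
  bigO [set a | 0 <= a <= m] n (fun h a => g (a * h)).
Proof.
move=> e0 c0 m0 H; exists (e / (m + 1)), (c * m ^+ n); split.
- by rewrite divr_gt0// ltr_wpDl.
- by rewrite mulr_ge0// exprn_ge0.
move=> h a /andP[h0 he] /andP[a0 am].
have ah0 : 0 <= a * h by rewrite mulr_ge0// ltW.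
have ahm : a * h <= m * h by rewrite ler_wpM2r// ltW.
rewrite (le_trans (H _ _))//.
  rewrite ah0 (le_trans ahm)//; move: he; rewrite ler_pdivlMr ?ltr_wpDl// => he.
  by rewrite (le_trans _ he)// mulrC ler_wpM2l ?ltW// ltrDl.
by rewrite -mulrA -exprMn ler_wpM2l// lerXn2r ?nnegrE// (le_trans ah0).
Qed.

Lemma small_step (R : realType) (Q : R -> Prop) :
  (\forall h \near 0^'+, Q h) -> exists2 h0, 0 < h0 & forall h, 0 < h <= h0 -> Q h.
Proof.
move=> HQ; have /nbhs_ballP[k /= k0 kQ] : \forall h \near (0 : R), 0 < h -> Q h by exact: HQ.
exists (k / 2); first by rewrite divr_gt0.
move=> h /andP[h0 hk]; apply: kQ => //; rewrite /ball/= sub0r normrN gtr0_norm//.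
by rewrite (le_lt_trans hk)// ltr_pdivrMr// ltr_pMr// ltr1n.
Qed.

Lemma near_pow_lt (R : realType) (k rho : R) n : 0 < rho ->
  \forall h \near 0^'+, k * h ^+ n.+1 < rho.
Proof.
move=> rho0; have H : k * h ^+ n.+1 @[h --> (0 : R)] --> k * 0 ^+ n.+1.
  by apply: cvgM; [exact: cvg_cst|exact: exprn_continuous].
rewrite expr0n/= mulr0 in H.
have : \forall h \near (0 : R), k * h ^+ n.+1 < rho by exact: (cvgr_lt 0 H rho rho0).
by move=> /nbhs_ballP[k0 /= k00 kQ]; exists k0 => // h hh _; exact: kQ.
Qed.

Section local_error.
Context {R : realType} {d : nat} {N : vnorm R d} {r : \bar R} {s : nat}.
Hypothesis hr : (0 <= r)%E.
Variables (M : fcrkn R s) (P : ivp N r) (K : R -> 'I_s -> 'rV[R]_d).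
Hypothesis KP : forall h, is_stages M P h (K h).
Local Notation V := 'rV[R]_d.
Local Notation J := (forward_set (sigma P) (tend P)).
Local Notation c := (rk_c M).

Variables (e e' : R) (y2 y3 y4 : V).
Hypotheses (e_gt0 : 0 < e) (e'_ge0 : 0 <= e').
Hypothesis sol_cont : {within `[sigma P, sigma P + e], continuous (sol P)}.
Hypothesis sol_exp : forall t, 0 <= t <= e -> [/\ J (sigma P + t),
    `|sol P (sigma P + t) -
      (phi P 0 + t *: slope P + (t ^+ 2 / 2) *: y2 + (t ^+ 3 / 6) *: y3)| <= e' * t ^+ 4,
    `|derive_within J (sol P) (sigma P + t) -
      (slope P + t *: y2 + (t ^+ 2 / 2) *: y3 + (t ^+ 3 / 6) *: y4)| <= e' * t ^+ 4 &
    `|derive_within J (derive_within J (sol P)) (sigma P + t) -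
      (y2 + t *: y3 + (t ^+ 2 / 2) *: y4)| <= e' * t ^+ 3].
Hypothesis ha : forall (i : 'I_s) (alpha : R), 0 <= alpha <= c i ->
  \sum_j (rk_a M i j).[alpha] = alpha ^+ 2 / 2.

Let U (t : R) : V := phi P 0 + t *: slope P + (t ^+ 2 / 2) *: y2 + (t ^+ 3 / 6) *: y3.
Let K2 (t : R) : V := y2 + t *: y3 + (t ^+ 2 / 2) *: y4.

Lemma sol_bigO m : 0 <= m ->
  bigO [set a | 0 <= a <= m] 4 (fun h a => sol P (sigma P + a * h) - U (a * h)).
Proof.
move=> m0; apply: (bigO_rescale (g := fun t => sol P (sigma P + t) - U t) e_gt0 e'_ge0 m0).
by move=> t /sol_exp[].
Qed.

Lemma dsol_bigO m : 0 <= m ->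
  bigO [set a | 0 <= a <= m] 4 (fun h a => derive_within J (sol P) (sigma P + a * h) -
    (slope P + (a * h) *: y2 + ((a * h) ^+ 2 / 2) *: y3 + ((a * h) ^+ 3 / 6) *: y4)).
Proof.
move=> m0; apply: (bigO_rescale (g := fun t => derive_within J (sol P) (sigma P + t) -
  (slope P + t *: y2 + (t ^+ 2 / 2) *: y3 + (t ^+ 3 / 6) *: y4)) e_gt0 e'_ge0 m0).
by move=> t /sol_exp[].
Qed.

(** For weights that sum to a^2/2 the terms in y2 cancel.  The remaining defect
    is of order n = 1 for the stages, and of order n = 2 for the final formula when
    its order condition holds. *)
Lemma nystrom_sol_bigO (w : 'I_s -> {poly R}) (m : R) n (A : set R) : 0 <= m ->
  A `<=` [set a | 0 <= a <= m] -> (n <= 2)%N ->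
  (forall a, A a -> \sum_j (w j).[a] = a ^+ 2 / 2) ->
  bigO A n (fun h a => \sum_j (w j).[a] *: (K h j - y2) - (a ^+ 3 / 6 * h) *: y3) ->
  bigO A (2 + n) (fun h a => nystrom P h (K h) w a - sol P (sigma P + a * h)).
Proof.
move=> m0 Am n2 wA /(bigO_pow 2) H.
have [h0 [k [h00 k0 solO]]] := bigO_weak (n2 : (2 + n <= 4)%N) (sol_bigO m0).
have solO' : bigO A (2 + n) (fun h a => -1 *: (sol P (sigma P + a * h) - U (a * h))).
  exists h0, k; split => // h x hh /Am Ax; rewrite scaleN1r normrN.
  exact: solO.
apply: bigO_ext (bigOD H solO') => h a h_gt0 Aa.
rewrite /nystrom /U.
have -> : \sum_j (w j).[a] *: K h j = \sum_j (w j).[a] *: (K h j - y2) + (a ^+ 2 / 2) *: y2.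
  by rewrite -wA// scaler_suml -big_split/=; apply: eq_bigr => j _; rewrite -scalerDr subrK.
by set S := \sum_j _; apply/rowP => l; rewrite !mxE; field.
Qed.

(** The two formulas for a stage function agree at 0 because a_ij(0) = 0. *)
Lemma stage_fun_continues h (i : 'I_s) : 0 < h ->
  continues (phi P) (stage_fun M P h (K h) i) (c i * h).
Proof.
move=> h0; split=> [x [_ x0]|]; first by rewrite /stage_fun x0.
apply: (@subspace_eq_continuous R `[0, c i * h]%classic V
  (fun x => nystrom P h (K h) (rk_a M i) (x / h))).
  move=> x; rewrite inE /= in_itv/= => /andP[x0 _].
  rewrite /from_subspace /stage_fun; case: leP => // x0'.
  have -> : x = 0 by apply/eqP; rewrite eq_le x0 x0'.
  rewrite mul0r /nystrom mul0r scale0r addr0 big1 ?scaler0 ?addr0// => j _.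
  by rewrite rk_a0 scale0r.
apply: continuous_subspaceT => x.
apply: cvgD.
  apply: cvgD; first exact: cvg_cst.
  apply: cvgZr_tmp; apply: cvgM; last exact: cvg_cst.
  by apply: cvgM; [exact: cvg_id|exact: cvg_cst].
apply: cvgZl_tmp; apply: cvg_big => [|j _]; [exact: add_continuous|apply: cvgZr_tmp].
apply: (@cvg_comp _ _ _ (fun x => x / h) (fun y => (rk_a M i j).[y])).
  by apply: cvgM; [exact: cvg_id|exact: cvg_cst].
exact: continuous_horner.
Qed.

Lemma sol_continues (tau : R) : tau <= e ->
  continues (phi P) (fun x => sol P (sigma P + x)) tau.
Proof.
move=> te; split=> [x xI|]; first exact: sol_phi.
apply/subspace_continuousP => x; rewrite /= in_itv/= => /andP[x0 xt].
have sx : `[sigma P, sigma P + e]%classic (sigma P + x).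
  by rewrite /= in_itv/= lerDl x0 lerD2l (le_trans xt).
move/subspace_continuousP : sol_cont => /(_ _ sx); apply: cvg_comp.
move=> A /= /nbhs_ballP[k /= k0 kA].
suff : \forall y \near x, y \in `[0, tau] -> A (sigma P + y) by [].
apply/nbhs_ballP; exists k => //= y xy; rewrite in_itv/= => /andP[y0 yt]; apply: kA.
  by rewrite /ball/= opprD addrACA subrr add0r.
by rewrite /= in_itv/= lerDl y0 lerD2l (le_trans yt).
Qed.

(** Measured against the Taylor polynomial of the second derivative of the
    solution rather than against that derivative itself, so that sums over the
    stages can be expanded in powers of h. *)
Definition stage_residual h (i : 'I_s) : V := K h i - K2 (c i * h).

Lemma stage_approx (i : 'I_s) :
  (forall j : 'I_s, (j < i)%N -> bigO [set: unit] 3 (fun h _ => stage_residual h j)) ->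
  bigO [set a | 0 <= a <= c i] 3
    (fun h a => nystrom P h (K h) (rk_a M i) a - sol P (sigma P + a * h)).
Proof.
move=> IH; apply: (nystrom_sol_bigO (n := 1) (rk_c_ge0 M i)) => //; first exact: ha.
have y3O : bigO [set a | 0 <= a <= c i] 1 (fun h a => (- (a ^+ 3 / 6)) *: (h ^+ 1 *: y3)).
  apply: (bigO_scale (m := (c i) ^+ 3 / 6)).
    move=> a /andP[a0 ai]; rewrite normrN ger0_norm ?divr_ge0 ?exprn_ge0//.
    by rewrite ler_pM2r ?invr_gt0// lerXn2r ?nnegrE// (le_trans a0).
  exact: (bigO_pow 1 (bigO_const _ y3)).
apply: (bigO_ext _ (bigOD _ y3O)) => [h a _ _|].
  by rewrite scalerA mulNr scaleNr expr1.
apply: bigO_sum => j _.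
have [ji|ij] := ltnP j i; last first.
  by apply: bigO_ext (bigO0 _ _) => h a _ _; rewrite rk_a_lower// horner0 scale0r.
have [m mP] := horner_bounded (rk_a M i j) 0 (c i).
apply: (bigO_scale (m := m)) => //.
have [h0 [k [h00 k0 H]]] := bigO_weak (isT : (1 <= 3)%N) (IH j ji).
have H1 : bigO [set a | 0 <= a <= c i] 1 (fun h _ => stage_residual h j).
  by exists h0, k; split => // h x hh _; exact: (H h tt).
have H2 : bigO [set a | 0 <= a <= c i] 1 (fun h _ => h ^+ 1 *: (c j *: y3)).
  exact: (bigO_pow 1 (bigO_const _ _)).
have H3 : bigO [set a | 0 <= a <= c i] 1 (fun h _ => h ^+ 2 *: ((c j ^+ 2 / 2) *: y4)).
  exact: (bigO_weak (isT : (1 <= 2)%N) (bigO_pow 2 (bigO_const _ _))).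
apply: bigO_ext (bigOD H1 (bigOD H2 H3)) => h a _ _.
by rewrite /stage_residual /K2; apply/rowP => l; rewrite !mxE; field.
Qed.

(** K_i is the right-hand side at the segment of the stage function, and the
    second derivative of the solution is the right-hand side at the segment of the
    solution; [rhs_lipschitz] compares the two. *)
Lemma stage_step (i : 'I_s) :
  (forall j : 'I_s, (j < i)%N -> bigO [set: unit] 3 (fun h _ => stage_residual h j)) ->
  bigO [set: unit] 3 (fun h _ => stage_residual h i).
Proof.
move=> /stage_approx[h1 [k1 [h10 k10 H1]]].
have [rho [L [rho0 L0 lipL]]] := rhs_lipschitz (ivp_rfde P) (ivp_dom P).
have [kN NK] := @vnorm_le R d N.
have rho20 : 0 < rho / 2 by rewrite divr_gt0.
have [eta eta0 etaP] := segment_near_initial hr rho20 e_gt0 (sol_continues (lexx e)).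
pose kk := `|kN| * k1.
have kk0 : 0 <= kk by rewrite mulr_ge0.
have [h0 h00 h0P] : exists2 h0, 0 < h0 & forall h, 0 < h <= h0 ->
    [/\ 1 * h ^+ 1 < h1, c i * h ^+ 1 < Num.min e (Num.min eta rho) & kk * h ^+ 3 < rho / 2].
  by apply: small_step; near=> h; split; near: h; apply: near_pow_lt => //;
     rewrite !lt_min e_gt0 eta0.
exists h0, (L * kk + e' * c i ^+ 3); split => //.
  by rewrite addr_ge0// mulr_ge0// exprn_ge0// rk_c_ge0.
move=> h _ hh0 _; have [] := h0P h hh0; rewrite mul1r !expr1 => hh1.
have h_gt0 : 0 < h by case/andP: hh0.
rewrite !lt_min => /and3P[the theta thrho] kkh.
set tau := c i * h in the theta thrho.
have tau0 : 0 <= tau by rewrite mulr_ge0 ?rk_c_ge0// ltW.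
have cstage := stage_fun_continues i h_gt0.
have csol := sol_continues (ltW the).
have I0 := @delay_set0 R r hr.
set w1 := stage_fun M P h (K h) i; set w2 := fun x => sol P (sigma P + x).
have w12 x : 0 <= x <= tau -> N (w1 x - w2 x) <= kk * h ^+ 3.
  move=> /andP[x0 xt]; have [xle0|xgt0] := leP x 0.
    have -> : x = 0 by apply/eqP; rewrite eq_le x0 xle0.
    by rewrite /w1 cstage.1// /w2 csol.1// subrr vnorm0 mulr_ge0// exprn_ge0// ltW.
  rewrite /w1 /stage_fun ifN -?ltNge//.
  have -> : w2 x = sol P (sigma P + x / h * h) by rewrite divfK// gt_eqF.
  rewrite (le_trans (NK _))// /kk -[leRHS]mulrA.
  rewrite (@le_trans _ _ (`|kN| *
    `|nystrom P h (K h) (rk_a M i) (x / h) - sol P (sigma P + x / h * h)|))//.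
    by rewrite ler_wpM2r ?ler_norm.
  apply: ler_wpM2l => //; apply: H1; first by rewrite h_gt0 ltW.
  by rewrite /= divr_ge0 ?(ltW h_gt0)//= ler_pdivrMr.
have kkh0 : 0 <= kk * h ^+ 3 by rewrite mulr_ge0// exprn_ge0// ltW.
have dist12 := segment_dist_le hr tau0 kkh0 cstage csol w12.
have near2 := etaP tau _; rewrite tau0 (ltW theta) in near2.
have {}near2 := near2 isT.
set psi1 := segment N r (fun x => w1 (tau + x)) in dist12 *.
set psi2 := segment N r (fun x => w2 (tau + x)) in dist12 near2 *.
(* Both segments are within rho of phi, so the Lipschitz estimate applies. *)
have near1 : `|psi1 - phi P| < rho.
  rewrite -[psi1 - _](subrKA psi2) (le_lt_trans (ler_normD _ _))//.
  by rewrite [rho]splitr ltr_leD// (le_lt_trans dist12).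
have near2' : `|psi2 - phi P| < rho.
  by rewrite (le_lt_trans near2)// ltr_pdivrMr// ltr_pMr// ltr1n.
have tsig : `|sigma P + tau - sigma P| < rho by rewrite addrAC subrr add0r ger0_norm.
have := lipL _ _ _ tsig near1 near2'.
have -> : rhs P (sigma P + tau, psi1) = K h i by rewrite [RHS]KP.
have texp : 0 <= tau <= e by rewrite tau0 ltW.
have [Jt _ _ ddexp] := sol_exp texp.
have -> : rhs P (sigma P + tau, psi2) =
    derive_within J (derive_within J (sol P)) (sigma P + tau).
  have [_ _ ->] := sol_eqn Jt; congr (rhs P (_, segment N r _)).
  by apply/funext => x; rewrite /w2 addrA.
move=> lip.
rewrite /stage_residual.
rewrite -[K h i - _](subrKA (derive_within J (derive_within J (sol P)) (sigma P + tau))).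
rewrite (le_trans (ler_normD _ _))// mulrDl lerD//.
  by rewrite (le_trans lip)// -mulrA ler_wpM2l.
by rewrite -mulrA -exprMn.
Unshelve. all: by end_near. Qed.

Lemma stage_bigO (i : 'I_s) : bigO [set: unit] 3 (fun h _ => stage_residual h i).
Proof.
have [n] := ubnP (i : nat); elim: n i => // n IH i.
by rewrite ltnS => le_in; apply: stage_step => j ji; apply: IH; exact: leq_trans le_in.
Qed.

Lemma stage_sum_bigO (w : 'I_s -> {poly R}) (m : R) (A : set R) :
  A `<=` [set a | 0 <= a <= m] ->
  bigO A 3 (fun h a => \sum_j (w j).[a] *: stage_residual h j).
Proof.
move=> Am; apply: bigO_sum => j _.
have [k kP] := horner_bounded (w j) 0 m.
apply: (bigO_scale (m := k)); first by move=> a /Am; exact: kP.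
have [h0 [k' [h00 k0 H]]] := stage_bigO j.
by exists h0, k'; split => // h x hh _; exact: (H h tt).
Qed.

Lemma stage_sumE (w : 'I_s -> {poly R}) h a :
  \sum_j (w j).[a] *: K h j = (\sum_j (w j).[a]) *: y2 +
    (\sum_j (w j).[a] * c j * h) *: y3 +
    (\sum_j (w j).[a] * c j ^+ 2 * (h ^+ 2 / 2)) *: y4 +
    \sum_j (w j).[a] *: stage_residual h j.
Proof.
rewrite !scaler_suml -!big_split/=; apply: eq_bigr => j _.
by rewrite /stage_residual /K2; apply/rowP => l; rewrite !mxE; field.
Qed.

Lemma err_bigO A : A `<=` `[0, 1]%classic ->
  (forall a, A a -> \sum_i (rk_b M i).[a] = a ^+ 2 / 2) ->
  (forall a, A a -> \sum_i (rk_b M i).[a] * c i = a ^+ 3 / 6) ->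
  bigO A 4 (fun h a => err M P h (K h) a).
Proof.
move=> A1 b1 b2.
have {}A1 : A `<=` [set a | 0 <= a <= 1] by move=> x /A1; rewrite /= in_itv.
apply: (nystrom_sol_bigO (n := 2) (m := 1)) => //.
(* The y4-terms of the stages only contribute at order h^4 here. *)
have yO : bigO A 2 (fun h a => (\sum_j (rk_b M j).[a] * c j ^+ 2) *: (h ^+ 2 *: (2^-1 *: y4))).
  have [k kP] := horner_bounded (\sum_j (c j ^+ 2) *: rk_b M j) 0 1.
  apply: (bigO_scale (m := k)) => [a /A1/kP|].
    rewrite horner_sum; congr (`|_| <= _); apply: eq_bigr => j _.
    by rewrite hornerZ mulrC.
  exact: (bigO_pow 2 (bigO_const _ _)).
apply: (bigO_ext _ (bigOD yO (bigO_weak (isT : (2 <= 3)%N) (stage_sum_bigO (rk_b M) A1)))).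
move=> h a h0 Aa.
have -> : \sum_j (rk_b M j).[a] *: (K h j - y2) =
   \sum_j (rk_b M j).[a] *: K h j - (\sum_j (rk_b M j).[a]) *: y2.
  rewrite scaler_suml -sumrB; apply: eq_bigr => j _; exact: scalerBr.
rewrite stage_sumE -!mulr_suml b2//.
set S := \sum_j _ *: stage_residual _ _; set S0 := \sum_j _; set S2 := \sum_j _ * _.
by apply/rowP => l; rewrite !mxE; field.
Qed.

Lemma err'_bigO A : A `<=` `[0, 1]%classic ->
  (forall a, A a -> \sum_i (rk_b' M i).[a] = a) ->
  (forall a, A a -> \sum_i (rk_b' M i).[a] * c i = a ^+ 2 / 2) ->
  (forall a, A a -> \sum_i (rk_b' M i).[a] * c i ^+ 2 = a ^+ 3 / 3) ->
  bigO A 4 (fun h a => err' M P h (K h) a).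
Proof.
move=> A1 b0 b1 b2.
have {}A1 : A `<=` [set a | 0 <= a <= 1] by move=> x /A1; rewrite /= in_itv.
have H1 := bigO_pow 1 (stage_sum_bigO (rk_b' M) A1).
have [h0 [k [h00 k0 dsolO]]] := dsol_bigO (@ler01 R).
pose D h a := derive_within J (sol P) (sigma P + a * h) -
    (slope P + (a * h) *: y2 + ((a * h) ^+ 2 / 2) *: y3 + ((a * h) ^+ 3 / 6) *: y4).
have H2 : bigO A 4 (fun h a => -1 *: D h a).
  exists h0, k; split => // h x hh /A1 Ax; rewrite scaleN1r normrN.
  exact: dsolO.
apply: (bigO_ext _ (bigOD H1 H2)) => h a hh Aa.
rewrite /err' /eta' stage_sumE -!mulr_suml b0// b1// b2// /D.
set S := \sum_j _ *: stage_residual _ _; set du := derive_within _ _ _.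
by apply/rowP => l; rewrite !mxE; field.
Qed.

End local_error.

(** * The order conditions are sufficient *)

Section sufficiency.
Context {R : realType} {d : nat} {N : vnorm R d} {r : \bar R} {s : nat}.

(** The smoothness class is C^5: the fifth derivative bounds the O(h^4) term of
    the error in the derivative. *)
Lemma order_conditions_sufficient (hr : (0 <= r)%E) (M : fcrkn R s)
    (asm : ivp N r -> Prop) (A : set R) : A `<=` `[0, 1]%classic ->
  (forall (i : 'I_s) (a : R), 0 <= a <= rk_c M i ->
    \sum_j (rk_a M i j).[a] = a ^+ 2 / 2) ->
  (forall a, A a -> \sum_i (rk_b M i).[a] = a ^+ 2 / 2) ->
  (forall a, A a -> \sum_i (rk_b M i).[a] * rk_c M i = a ^+ 3 / 6) ->
  (forall a, A a -> \sum_i (rk_b' M i).[a] = a) ->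
  (forall a, A a -> \sum_i (rk_b' M i).[a] * rk_c M i = a ^+ 2 / 2) ->
  (forall a, A a -> \sum_i (rk_b' M i).[a] * rk_c M i ^+ 2 = a ^+ 3 / 3) ->
  has_order asm M 3 A.
Proof.
move=> A1 ha b0 b1 b'0 b'1 b'2; exists 5 => P _ uC.
have [e [c [y2 [y3 [y4 [e0 c0 uc uexp]]]]]] := sol_expansion hr uC.
have [K KP] := choice (is_stages_exists M P).
have [h1 [k1 [h10 k10 H1]]] := err_bigO hr KP e0 c0 uc uexp ha A1 b0 b1.
have [h2 [k2 [h20 k20 H2]]] := err'_bigO hr KP e0 c0 uc uexp ha A1 b'0 b'1 b'2.
have [kN NK] := @vnorm_le R d N.
have NKb (x : 'rV[R]_d) k h : `|x| <= k * h ^+ 4 -> 0 < h -> N x <= (`|kN| * k + 1) * h ^+ 4.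
  move=> xk h0; have h40 : 0 <= h ^+ 4 by rewrite exprn_ge0// ltW.
  rewrite (le_trans (NK x))// mulrDl ler_wpDr ?mul1r//.
  rewrite -mulrA (@le_trans _ _ (`|kN| * `|x|))//; last by rewrite ler_wpM2l.
  by rewrite ler_wpM2r// ler_norm.
exists (Num.min h1 h2), (`|kN| * k1 + 1), (`|kN| * k2 + 1); split.
- by rewrite lt_min h10.
- by rewrite ltr_wpDl// mulr_ge0.
- by rewrite ltr_wpDl// mulr_ge0.
move=> h K' /andP[h0]; rewrite le_min => /andP[hh1 hh2] KP' a Aa.
have -> : K' = K h by apply/funext; exact: is_stages_uniq KP' (KP h).
by split; apply: NKb => //; [apply: H1|apply: H2]; rewrite ?h0.
Qed.

End sufficiency.

(** * Polynomial test problems *)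

Section polynomial_curves.
Context {R : realType} {V : normedModType R}.
Implicit Types (A : set R) (p : {poly R}) (v : V) (g : R -> V).

(** Every point of the set lies in a nontrivial interval of the set, so that
    derivatives relative to the set are unique. *)
Definition thick A : Prop := forall t, A t -> exists a b : R,
  [/\ a < b, a <= t <= b & `[a, b] `<=` A].

Lemma thick_itv (a b : R) : a < b -> thick `[a, b]%classic.
Proof. by move=> ab t; rewrite /= in_itv/= => tab; exists a, b; split. Qed.

Lemma derive_within_horner A g p v : thick A -> (forall x, A x -> g x = p.[x] *: v) ->
  forall t, A t -> derivable_within A g t /\ derive_within A g t = p^`().[t] *: v.
Proof.
move=> tA gp t At; have [a [b [ab tab abA]]] := tA t At.
have PA := within_dnbhs_proper ab tab abA.
have H : diff_quotient g t @ within A t^' --> p^`().[t] *: v.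
  have loc : \forall x \near t, (A x <-> A x) /\ (A x -> g x = p.[x] *: v).
    by near=> x; split => // /gp.
  rewrite (diff_quotient_local loc (gp t At)).
  exact: diff_quotient_horner.
split; last exact: derive_within_cvg.
by apply/cvg_ex; exists (p^`().[t] *: v); exact: H.
Unshelve. all: by end_near. Qed.

Lemma iter_derive_within_horner A g p v k : thick A -> (forall x, A x -> g x = p.[x] *: v) ->
  forall t, A t -> iter k (derive_within A) g t = p^`(k).[t] *: v.
Proof.
move=> tA gp; elim: k => [|k IH] t At; first by rewrite /= gp.
by rewrite iterS derivnS; have [_ ->] := derive_within_horner tA IH At.
Qed.

Lemma class_C_horner k (a b : R) g p v : a < b ->
  (forall x, a <= x <= b -> g x = p.[x] *: v) -> class_C k `[a, b] g.
Proof.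
move=> ab gp'; have tA := thick_itv ab.
have gp x : `[a, b]%classic x -> g x = p.[x] *: v by rewrite /= in_itv/=; exact: gp'.
split=> [i t _ tab|].
  by have [] := derive_within_horner tA (iter_derive_within_horner i tA gp) tab.
apply: (@subspace_eq_continuous R `[a, b]%classic V (fun x => p^`(k).[x] *: v)).
  move=> x; rewrite inE => xab.
  by rewrite /from_subspace (iter_derive_within_horner k tA gp xab).
apply: continuous_subspaceT => x; apply: cvgZr_tmp; exact: continuous_horner.
Qed.

End polynomial_curves.

Lemma differentiable_constant (R : realType) (W W' : normedModType R) (F : W -> W') (x : W) :
  (forall y, F y = F x) -> differentiable F x /\ forall y, 'd F x y = 0.
Proof.
move=> Fx; have -> : F = cst (F x) by apply/funext => y; rewrite Fx.
by split=> [|y]; [exact: differentiable_cst|rewrite diff_cst].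
Qed.

Section test_problem.
Context {R : realType} {d : nat} {N : vnorm R d} {r : \bar R}.
Local Notation V := 'rV[R]_d.
Local Notation C := (phase N r).
Variables (m : nat) (v : V).

Definition test_rhs (x : R * C) : V := x.1 ^+ m *: v.

Definition test_poly : {poly R} := ((m.+1 * m.+2)%:R)^-1 *: 'X^(m.+2).

(** Zero history, so that the problem is admissible for every delay r. *)
Definition test_sol (t : R) : V := if t <= 0 then 0 else test_poly.[t] *: v.

Lemma horner_test_poly t : test_poly.[t] = t ^+ m.+2 / (m.+1 * m.+2)%:R.
Proof. by rewrite /test_poly hornerZ hornerXn mulrC. Qed.

Lemma deriv_test_poly : test_poly^`() = (m.+1%:R)^-1 *: 'X^(m.+1).
Proof.
rewrite /test_poly derivZ derivXn -scalerMnr scalerMnl /= -mulr_natr natrM invfM.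
by rewrite -mulrA mulVf ?mulr1// pnatr_eq0.
Qed.

Lemma deriv2_test_poly : (test_poly^`())^`() = 'X^m :> {poly R}.
Proof.
rewrite deriv_test_poly derivZ derivXn -scalerMnr scalerMnl /= -mulr_natr.
by rewrite mulVf ?scale1r// pnatr_eq0.
Qed.

Lemma test_sol_pos t : 0 <= t -> test_sol t = test_poly.[t] *: v.
Proof.
move=> t0; rewrite /test_sol; case: ifP => // t0'.
have -> : t = 0 by apply/eqP; rewrite eq_le t0 t0'.
by rewrite horner_test_poly expr0n mul0r scale0r.
Qed.

Lemma test_sol_neg t : t <= 0 -> test_sol t = 0.
Proof. by rewrite /test_sol => ->. Qed.

Local Notation J := (forward_set (0 : R) +oo%E).

Lemma forward_setE t : J t <-> 0 <= t.
Proof. by split=> [[]//|t0]; split => //; rewrite ltry. Qed.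

Lemma thick_forward : thick J.
Proof.
move=> t /forward_setE t0; exists t, (t + 1); rewrite ltrDl ltr01 lexx lerDl ler01.
split => // x; rewrite /= in_itv/= => /andP[tx _]; apply/forward_setE.
exact: le_trans tx.
Qed.

Lemma test_sol_forward t : J t -> test_sol t = test_poly.[t] *: v.
Proof. by move=> /forward_setE; exact: test_sol_pos. Qed.

Lemma test_rfde : rfde [set: R * C] test_rhs.
Proof.
have d0 (x : R * C) (chi : C) : state_derivative test_rhs x chi = 0.
  by have [_ /(_ chi)] := @differentiable_constant R C V
    (fun psi => test_rhs (x.1, psi)) x.2 (fun=> erefl).
split.
- exact: openT.
- move=> x _; apply: cvgZr_tmp.
  apply: (@cvg_comp _ _ _ fst (fun t : R => t ^+ m)); first exact: cvg_fst.
  exact: exprn_continuous.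
- move=> t phi _; split.
    by have [] := @differentiable_constant R C V
      (fun psi => test_rhs (t, psi)) phi (fun=> erefl).
  move=> e e0; near=> psi => chi; rewrite !d0 subrr vnorm0.
  by rewrite mulr_ge0// ltW.
- by exists 0 => x chi _; rewrite d0 vnorm0 mul0r.
Unshelve. all: by end_near. Qed.

Lemma test_solution :
  noncontinuable_solution [set: R * C] test_rhs 0 (0 : C) 0 +oo%E test_sol.
Proof.
have D1 := derive_within_horner thick_forward test_sol_forward.
have D2 := derive_within_horner thick_forward (fun t Jt => (D1 t Jt).2).
split; last by move=> [T' [w []]]; rewrite ltNge leey.
split.
- exact: ltry.
- split=> [|th [_ th0]]; last by rewrite add0r test_sol_neg.
  have -> : diff_quotient (0 : C) 0 = fun=> 0.
    by apply/funext => x; rewrite /diff_quotient subrr scaler0.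
  exact: cvg_cst.
- have J0 : J 0 by apply/forward_setE.
  by rewrite (D1 0 J0).2 deriv_test_poly !hornerE expr0n/= mulr0 scale0r.
- move=> t Jt; split => //.
  + by have [] := D1 t Jt.
  + by have [] := D2 t Jt.
  + by rewrite (D2 t Jt).2 deriv2_test_poly hornerXn.
Qed.

Definition test_ivp : ivp N r :=
  Ivp (phi := 0) test_rfde I test_solution.

(** The only break point is 0, where the zero history meets the polynomial. *)
Lemma test_piecewise k : piecewise_class_C k (sol_set test_ivp) (sol test_ivp).
Proof.
exists [set 0]; split=> [a b _|a b ab _ B0].
  exact: finite_setIl.
have [b0|b0] := leP b 0.
  apply: (@class_C_horner R V k a b _ 0 v ab) => x /andP[_ xb].
  by rewrite horner0 scale0r /= test_sol_neg// (le_trans xb).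
have [a0|a0] := leP 0 a.
  apply: (@class_C_horner R V k a b _ test_poly v ab) => x /andP[ax _].
  by rewrite /= test_sol_pos// (le_trans a0).
suff : ([set 0] `&` `]a, b[) (0 : R) by rewrite B0.
by split => //=; rewrite in_itv/= a0.
Qed.

End test_problem.

(** * The order conditions are necessary *)

Section necessity.
Context {R : realType} {d : nat} {N : vnorm R d} {r : \bar R} {s : nat}.
Local Notation V := 'rV[R]_d.
Variables (M : fcrkn R s) (m : nat) (v : V).
Local Notation P := (test_ivp (N := N) (r := r) m v).
Local Notation c := (rk_c M).

Definition test_stages (h : R) (i : 'I_s) : V := (c i * h) ^+ m *: v.

Lemma test_stagesP h : is_stages M P h (test_stages h).
Proof. by move=> i; rewrite /test_stages /= /test_rhs /= add0r. Qed.

Lemma test_sum (w : 'I_s -> {poly R}) h a :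
  \sum_j (w j).[a] *: test_stages h j =
    (h ^+ m * \sum_j (w j).[a] * c j ^+ m) *: v.
Proof.
rewrite mulr_sumr scaler_suml; apply: eq_bigr => j _.
by rewrite /test_stages scalerA exprMn; congr (_ *: _); ring.
Qed.

Lemma test_err h a : 0 <= h -> 0 <= a -> err M P h (test_stages h) a =
  (h ^+ m.+2 * (\sum_j (rk_b M j).[a] * c j ^+ m - a ^+ m.+2 / (m.+1 * m.+2)%:R)) *: v.
Proof.
move=> h0 a0; rewrite /err /Defs.eta /nystrom test_sum /= add0r.
rewrite test_sol_pos; last by rewrite ?add0r mulr_ge0.
rewrite ?add0r scaler0 ?add0r ?addr0 scalerA -scalerBl horner_test_poly; congr (_ *: _).
by rewrite !exprMn -[m.+2]addn2 !exprD; ring.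
Qed.

Lemma test_err' h a : 0 <= h -> 0 <= a -> err' M P h (test_stages h) a =
  (h ^+ m.+1 * (\sum_j (rk_b' M j).[a] * c j ^+ m - a ^+ m.+1 / m.+1%:R)) *: v.
Proof.
move=> h0 a0; rewrite /err' /eta' test_sum /= !add0r.
have Jt : forward_set 0 +oo%E (a * h) by apply/forward_setE; exact: mulr_ge0.
rewrite (derive_within_horner thick_forward (@test_sol_forward R d m v) Jt).2.
rewrite deriv_test_poly hornerZ hornerXn scalerA -scalerBl; congr (_ *: _).
by rewrite !exprMn !exprS; ring.
Qed.

(** Dividing by h^n leaves |x| <= k h^(p-n), which tends to 0. *)
Lemma pow_bound_eq0 (x k h0 : R) (n p : nat) : (n < p)%N -> 0 < h0 ->
  (forall h, 0 < h <= h0 -> h ^+ n * `|x| <= k * h ^+ p) -> x = 0.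
Proof.
move=> np h00 H; apply/eqP; rewrite -normr_le0 leNgt; apply/negP => x0.
have [h1 h10 H1] := small_step (near_pow_lt k (p - n).-1 x0).
pose h := Num.min h0 h1.
have hp : 0 < h by rewrite lt_min h00.
have hh0 : 0 < h <= h0 by rewrite hp ge_min lexx.
have hh1 : 0 < h <= h1 by rewrite hp ge_min lexx orbT.
have := H1 h hh1; rewrite prednK ?subn_gt0// ltNge => /negP; apply.
have := H h hh0; rewrite -[in k * _](subnKC (ltnW np)) exprD mulrCA.
by rewrite ler_pM2l// exprn_gt0.
Qed.

Lemma order_condition_necessary (A : set R) (p : nat) a : v != 0 ->
  err_order M P A p -> A a -> 0 <= a ->
  ((m.+2 <= p)%N -> \sum_j (rk_b M j).[a] * c j ^+ m = a ^+ m.+2 / (m.+1 * m.+2)%:R) /\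
  ((m.+1 <= p)%N -> \sum_j (rk_b' M j).[a] * c j ^+ m = a ^+ m.+1 / m.+1%:R).
Proof.
move=> v0 [h0 [k [k' [h00 k0 k'0 H]]]] Aa a0.
have Nv : 0 < N v.
  rewrite lt_neqAle vnorm_ge0 andbT; apply/eqP => /esym/vnorm_eq0 E.
  by rewrite E eqxx in v0.
have norm_eq (h x : R) n : 0 < h -> N ((h ^+ n * x) *: v) = h ^+ n * `|x * N v|.
  move=> hp; rewrite vnormZ !normrM (ger0_norm (ltW Nv)) -mulrA.
  by rewrite ger0_norm// exprn_ge0// ltW.
split=> mp; apply/eqP; rewrite -subr_eq0; apply/eqP.
- have : (\sum_j (rk_b M j).[a] * c j ^+ m - a ^+ m.+2 / (m.+1 * m.+2)%:R) * N v = 0.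
    apply: (@pow_bound_eq0 _ k h0 m.+2 p.+1) => // h hh.
    have hp : 0 < h by case/andP: hh.
    have [+ _] := H h _ hh (test_stagesP h) a Aa.
    by rewrite test_err ?(ltW hp)// norm_eq.
  by move/eqP; rewrite mulf_eq0 (gt_eqF Nv) orbF => /eqP.
- have : (\sum_j (rk_b' M j).[a] * c j ^+ m - a ^+ m.+1 / m.+1%:R) * N v = 0.
    apply: (@pow_bound_eq0 _ k' h0 m.+1 p.+1) => // h hh.
    have hp : 0 < h by case/andP: hh.
    have [_] := H h _ hh (test_stagesP h) a Aa.
    by rewrite test_err' ?(ltW hp)// norm_eq.
  by move/eqP; rewrite mulf_eq0 (gt_eqF Nv) orbF => /eqP.
Qed.

End necessity.

Section characterization.
Context {R : realType} {d : nat} {N : vnorm R d} {r : \bar R} {s : nat}.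
Hypotheses (hd : (0 < d)%N) (hr : (0 <= r)%E).
Variable M : fcrkn R s.

Let smooth (P : ivp N r) :=
  C1_in_state (dom P) (rhs P) /\ piecewise_class_C 4 (sol_set P) (sol P).

Lemma has_order_necessary (A : set R) (p m : nat) a :
  has_order smooth M p A -> A a -> 0 <= a ->
  ((m.+2 <= p)%N ->
    \sum_j (rk_b M j).[a] * rk_c M j ^+ m = a ^+ m.+2 / (m.+1 * m.+2)%:R) /\
  ((m.+1 <= p)%N ->
    \sum_j (rk_b' M j).[a] * rk_c M j ^+ m = a ^+ m.+1 / m.+1%:R).
Proof.
move=> [k H]; pose v : 'rV[R]_d := const_mx 1.
apply: (order_condition_necessary (N := N) (r := r) (v := v)).
  apply/eqP => /rowP/(_ (Ordinal hd)); rewrite !mxE => /eqP.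
  by rewrite oner_eq0.
apply: H; last exact: test_piecewise.
split; last exact: test_piecewise.
by have [_ _ ? _] := @test_rfde R d N r m v.
Qed.

Lemma order3_iff (A : set R) : A `<=` `[0, 1]%classic ->
  (forall a, 0 <= a <= 1 -> \sum_i (rk_b' M i).[a] = a) ->
  (forall a, 0 <= a <= 1 -> \sum_i (rk_b M i).[a] = a ^+ 2 / 2) ->
  (forall (i : 'I_s) (a : R), 0 <= a <= rk_c M i ->
     \sum_j (rk_a M i j).[a] = a ^+ 2 / 2) ->
  uniform_order smooth M 2 ->
  has_order smooth M 3 A <->
    forall a, A a ->
      \sum_i (rk_b' M i).[a] * rk_c M i ^+ 2 = a ^+ 3 / 3 /\
      \sum_i (rk_b M i).[a] * rk_c M i = a ^+ 3 / 6.
Proof.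
move=> A1 hb' hb ha order2.
have A01 a : A a -> 0 <= a <= 1 by move/A1; rewrite /= in_itv.
split=> [order3 a Aa|cond].
  have a0 : 0 <= a by case/andP: (A01 a Aa).
  split.
    by have [_ ->] := has_order_necessary 2 order3 Aa a0.
  have [+ _] := has_order_necessary 1 order3 Aa a0.
  move=> /(_ isT) <-; apply: eq_bigr => i _; by rewrite expr1.
apply: order_conditions_sufficient => //.
- by move=> a /A01; exact: hb.
- by move=> a /cond[].
- by move=> a /A01; exact: hb'.
- move=> a /A1 a1.
  have a0 : 0 <= a by move: a1; rewrite /= in_itv/= => /andP[].
  have [_ /(_ isT) <-] := has_order_necessary 1 order2 a1 a0.
  by apply: eq_bigr => i _; rewrite expr1.
- by move=> a /cond[].
Qed.

End characterization.

Unset Implicit Arguments.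

Theorem theorem2 (R : realType) (d : nat) (hd : (0 < d)%N) (N : vnorm R d)
  (r : \bar R) (hr : (0 <= r)%E) (s : nat) (M : fcrkn R s)
  (hb' : forall alpha : R, 0 <= alpha <= 1 ->
     \sum_i (rk_b' M i).[alpha] = alpha)
  (hb : forall alpha : R, 0 <= alpha <= 1 ->
     \sum_i (rk_b M i).[alpha] = alpha ^+ 2 / 2)
  (ha : forall (i : 'I_s) (alpha : R), 0 <= alpha <= rk_c M i ->
     \sum_j (rk_a M i j).[alpha] = alpha ^+ 2 / 2) :
  let smooth := fun P : ivp N r =>
    C1_in_state (dom P) (rhs P) /\ piecewise_class_C 4 (sol_set P) (sol P) in
  uniform_order smooth M 2 ->
  (uniform_order smooth M 3 <->
     forall alpha : R, 0 <= alpha <= 1 ->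
       \sum_i (rk_b' M i).[alpha] * rk_c M i ^+ 2 = alpha ^+ 3 / 3 /\
       \sum_i (rk_b M i).[alpha] * rk_c M i = alpha ^+ 3 / 6) /\
  (discrete_order smooth M 3 <->
     \sum_i (rk_b' M i).[1] * rk_c M i ^+ 2 = 1 / 3 /\
     \sum_i (rk_b M i).[1] * rk_c M i = 1 / 6).
Proof.
move=> smooth order2; split.
- have := order3_iff hd hr (@subset_refl _ `[0, 1]%classic) hb' hb ha order2.
  by move=> [to from]; split=> [/to H a a01|H]; [apply: H|apply: from => a];
    rewrite /= in_itv//=; exact: H.
- have sub1 : [set (1 : R)] `<=` `[0, 1]%classic.
    by move=> _ ->; rewrite /= in_itv/= ler01 lexx.
  have [to from] := order3_iff hd hr sub1 hb' hb ha order2.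
  split=> [/to/(_ 1 erefl)|H]; first by rewrite !expr1n.
  by apply: from => _ ->; rewrite !expr1n.
Qed.
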